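(* Let $\alpha$ be a continuous rotationally symmetric norm and $n\ge1$. Every $n$-outer function in $H^\alpha$ which belongs to $M_{\alpha}(z^n)$ is an outer function in $H^\alpha$.
   Context: $\mathbb T$ is the unit circle with normalized Lebesgue measure $m$. A norm $\alpha$ on $L^\infty$ is rotationally symmetric if $\alpha(1)=1$, $\alpha(|f|)=\alpha(f)$, and $\alpha(f_w)=\alpha(f)$ for all $f\in L^\infty$, $w\in\mathbb T$, where $f_w(z)=f(\overline w z)$; it is continuous if $\alpha(\chi_E)\to0$ as $m(E)\to0^+$. It is extended to measurable $f$ by $\alpha(f)=\sup\{\alpha(s): s\text{ simple},0\le s\le|f|\}$. $H^\alpha$ is the $\alpha$-closure of $H^\infty$; $[S]_\alpha$ denotes $\alpha$-closure. $H^\infty(z^n)=\{g(z^n): g\in H^\infty\}$ and $M_\alpha(z^n)=[H^\infty(z^n)]_\alpha$. A function $f\in H^\alpha$ is outer in $H^\alpha$ if $[f\cdot H^\infty]_\alpha=H^\alpha$. A function $f\in H^\alpha$ is $n$-outer in $H^\alpha$ if $[f\cdot H^\infty(z^n)]_\alpha=p(z)M_\alpha(z^n)$ for some polynomial $p$ of degree less than $n$.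
   Formalization: In the definition of n-outer the polynomial p of degree less than n is required to be nonzero; with p = 0 allowed, f = 0 would be n-outer and in M_α(z^n) but not outer. *)

(* Defs.v *)
(* The unit circle T is parametrised by
   t in [0,1[ via circ t = exp(2 pi i t); normalized Lebesgue measure m on T is
   the push-forward of Lebesgue measure on [0,1[.  "Functions on T" are
   represented by functions C -> C, of which only the values on T matter. *)
From mathcomp Require Import all_boot all_algebra.
From mathcomp Require Import all_classical all_reals all_analysis.
From mathcomp Require Import complex.
Set Implicit Arguments.
Unset Strict Implicit.
Unset Printing Implicit Defensive.
Import GRing.Theory Num.Theory.
Local Open Scope classical_set_scope.
Local Open Scope ring_scope.

Definition cfun (R : realType) := R[i] -> R[i].

Definition circ (R : realType) (t : R) : R[i] :=
  Complex (cos (2 * pi * t)) (sin (2 * pi * t)).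

Definition I01 (R : realType) : set R := `[0, 1[%classic.

Definition mT (R : realType) (E : set R[i]) : \bar R :=
  (@lebesgue_measure R) (@I01 R `&` (@circ R) @^-1` E).

Definition Tmeasurable (R : realType) (E : set R[i]) : Prop :=
  measurable (@I01 R `&` (@circ R) @^-1` E).

Definition Tmeasurable_fun (R : realType) (f : cfun R) : Prop :=
  measurable_fun (@I01 R) (fun t => complex.Re (f (circ t))) /\
  measurable_fun (@I01 R) (fun t => complex.Im (f (circ t))).

Definition aeeq (R : realType) (f g : cfun R) : Prop :=
  (@lebesgue_measure R).-negligible
    (@I01 R `&` [set t | f (circ t) <> g (circ t)]).

Definition Linf (R : realType) (f : cfun R) : Prop :=
  Tmeasurable_fun f /\
  exists M : R, (@lebesgue_measure R).-negligible
    (@I01 R `&` [set t | ~ (`|f (circ t)| <= (M%:C)%C)]).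

Definition chi (R : realType) (E : set R[i]) : cfun R :=
  fun z => if `[< E z >] then 1 else 0.

Definition Linf_norm (R : realType) (alpha : cfun R -> R) : Prop :=
  [/\ (forall f, Linf f -> 0 <= alpha f),
      (forall f, Linf f -> (alpha f = 0 <-> aeeq f (fun _ => 0))),
      (forall f (c : R[i]), Linf f ->
          ((alpha (fun z => c * f z))%:C)%C = `|c| * ((alpha f)%:C)%C),
      (forall f g, Linf f -> Linf g ->
          alpha (fun z => f z + g z) <= alpha f + alpha g) &
      (forall f g, Linf f -> Linf g -> aeeq f g -> alpha f = alpha g)].

Definition rot_sym_norm (R : realType) (alpha : cfun R -> R) : Prop :=
  [/\ Linf_norm alpha,
      alpha (fun _ => 1) = 1,
      (forall f, Linf f -> alpha (fun z => `|f z|) = alpha f) &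
      (forall f (w : R[i]), Linf f -> `|w| = 1 ->
          alpha (fun z => f (Num.conj w * z)) = alpha f)].

Definition cont_norm (R : realType) (alpha : cfun R -> R) : Prop :=
  forall eps : R, 0 < eps -> exists2 delta : R, 0 < delta &
    forall E : set R[i], Tmeasurable E -> (mT E < delta%:E)%E ->
      alpha (chi E) < eps.

Definition Tsimple (R : realType) (s : cfun R) : Prop :=
  Tmeasurable_fun s /\ finite_set (range (fun t : R => s (circ t))).

Definition alpha_ext (R : realType) (alpha : cfun R -> R) (f : cfun R)
  : \bar R :=
  ereal_sup [set (alpha s)%:E | s in
    [set s | Tsimple s /\ forall t : R, 0 <= s (circ t) <= `|f (circ t)|]].

Definition aclos (R : realType) (alpha : cfun R -> R) (S : set (cfun R))
  : set (cfun R) :=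
  [set f | Tmeasurable_fun f /\
    forall eps : R, 0 < eps ->
      exists2 s, S s & (alpha_ext alpha (fun z => (f z - s z)%R) < eps%:E)%E].

(* H^infty: functions in L^infty whose negative Fourier coefficients vanish *)
Definition Hinf (R : realType) : set (cfun R) :=
  [set f | Linf f /\ forall k : nat, (0 < k)%N ->
     (\int[@lebesgue_measure R]_(t in @I01 R)
         (complex.Re (f (circ t) * circ t ^+ k))%:E = 0)%E /\
     (\int[@lebesgue_measure R]_(t in @I01 R)
         (complex.Im (f (circ t) * circ t ^+ k))%:E = 0)%E].

Definition Halpha (R : realType) (alpha : cfun R -> R) : set (cfun R) :=
  aclos alpha (@Hinf R).

Definition Hinf_zn (R : realType) (n : nat) : set (cfun R) :=
  [set f | exists2 g, Hinf g & f = (fun z => g (z ^+ n))].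

Definition Malpha (R : realType) (alpha : cfun R -> R) (n : nat)
  : set (cfun R) :=
  aclos alpha (@Hinf_zn R n).

Definition fmul (R : realType) (f : cfun R) (S : set (cfun R)) : set (cfun R) :=
  [set (fun z => f z * h z) | h in S].

Definition outer (R : realType) (alpha : cfun R -> R) (f : cfun R) : Prop :=
  Halpha alpha f /\ aclos alpha (fmul f (@Hinf R)) = Halpha alpha.

(* p(z) M_alpha(z^n), as a set of elements of L^alpha (i.e. up to a.e.) *)
Definition polymul (R : realType) (p : {poly R[i]}) (M : set (cfun R))
  : set (cfun R) :=
  [set g | Tmeasurable_fun g /\
     exists2 h, M h & aeeq g (fun z => p.[z] * h z)].

Definition n_outer (R : realType) (alpha : cfun R -> R) (n : nat)
  (f : cfun R) : Prop :=
  Halpha alpha f /\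
  exists p : {poly R[i]}, [/\ p != 0, (size p <= n)%N &
     aclos alpha (fmul f (@Hinf_zn R n)) = polymul p (Malpha alpha n)].

(* Main.v *)
(** If [f] lies in [M_alpha(z^n)], then so does [[f H^infty(z^n)] = p M_alpha(z^n)],
    hence so does [p].  Elements of [H^infty(z^n)] are invariant under the rotation
    by [w = exp (2 i pi / n)], and [alpha] is rotation invariant, so that
    [p(w z) = p(z)]; as [deg p < n], [p] is a nonzero constant.  Therefore [1] lies in
    the closure of [f H^infty(z^n)], which is contained in that of [f H^infty], and
    multiplying by [H^infty] gives all of [H^alpha].

    This rests on [H^infty] being an algebra that contains [H^infty(z^n)], although it
    is defined by the vanishing of Fourier coefficients.  Both facts follow from the
    [L^2]-density of trigonometric polynomials: an element of [H^infty] is then an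
    [L^2]-limit of analytic polynomials.  Density, as well as the invariance of Lebesgue
    measure under [z |-> z^n], comes from a monotone class argument: the iterates of
    [x |-> x (3 - x^2) / 2] converge to the sign function on [[-1, 1]], and applied to
    [sin (pi t) sin (pi (t - x))] they produce the indicator functions of intervals. *)
Require Import Defs.
From mathcomp Require Import all_boot all_order all_algebra.
From mathcomp Require Import all_classical all_reals all_analysis.
From mathcomp Require Import complex measurable_realfun.
From mathcomp Require Import ring lra.
Set Implicit Arguments.
Unset Strict Implicit.
Unset Printing Implicit Defensive.
Import Order.TTheory GRing.Theory Num.Theory.
Import numFieldNormedType.Exports.
Import Normc.
Local Open Scope classical_set_scope.
Local Open Scope ring_scope.

(** * Bounded measurable real functions on the parameter interval and their means *)

Section BoundedMeasurable.
Context {R : realType}.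
Local Notation I01 := (@I01 R).
Local Notation mu := (@lebesgue_measure R).
Implicit Types (u v : R -> R).

Lemma measurable_I01 : measurable I01.
Proof. exact: measurable_itv. Qed.

Lemma mu_I01 : mu I01 = 1%E.
Proof. by rewrite /Defs.I01 lebesgue_measure_itv/= lte_fin ltr01 oppr0 adde0. Qed.

(** The bound holds at every point of [I01], not just almost everywhere; essentially bounded
    functions are brought to this form by truncation later on. *)
Definition bddmeas u := measurable_fun I01 u /\
  exists M, forall t, I01 t -> `|u t| <= M.

Lemma bddmeas_cst (r : R) : bddmeas (fun=> r).
Proof. by split; [exact: measurable_cst|exists `|r|]. Qed.

Lemma bddmeasD u v : bddmeas u -> bddmeas v -> bddmeas (fun t => u t + v t).
Proof.
move=> [mu_ [M uM]] [mv [N vN]]; split; first exact: measurable_funD.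
by exists (M + N) => t It; rewrite (le_trans (ler_normD _ _))// lerD ?uM ?vN.
Qed.

Lemma bddmeasM u v : bddmeas u -> bddmeas v -> bddmeas (fun t => u t * v t).
Proof.
move=> [mu_ [M uM]] [mv [N vN]]; split; first exact: measurable_funM.
by exists (M * N) => t It; rewrite normrM ler_pM ?uM ?vN.
Qed.

Lemma bddmeasN u : bddmeas u -> bddmeas (fun t => - u t).
Proof.
move=> bu; have := bddmeasM (bddmeas_cst (-1)) bu.
by under eq_fun do rewrite mulN1r.
Qed.

Lemma bddmeasB u v : bddmeas u -> bddmeas v -> bddmeas (fun t => u t - v t).
Proof. by move=> bu /bddmeasN; exact: bddmeasD. Qed.

Lemma bddmeasX u k : bddmeas u -> bddmeas (fun t => u t ^+ k).
Proof.
move=> bu; elim: k => [|k IH]; first by under eq_fun do rewrite expr0; exact: bddmeas_cst.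
by under eq_fun do rewrite exprS; exact: bddmeasM.
Qed.

Lemma bddmeas_eq u v : (forall t, I01 t -> u t = v t) -> bddmeas u -> bddmeas v.
Proof.
move=> uv [mu_ [M uM]]; split.
  by apply: eq_measurable_fun mu_ => t /set_mem /uv.
by exists M => t It; rewrite -uv// uM.
Qed.

Lemma bddmeas_integrable u : bddmeas u -> mu.-integrable I01 (EFin \o u).
Proof.
move=> [mu_ [M uM]]; apply: measurable_bounded_integrable => //.
- exact: measurable_I01.
- exact: (eq_ind_r (fun x => (x < +oo)%E) (ltry 1) mu_I01).
- exists M; split; first exact: num_real.
  by move=> x Mx t It /=; rewrite (le_trans (uM _ It))// ltW.
Qed.
Local Hint Resolve measurable_I01 bddmeas_integrable : core.

Definition mean u := \int[mu]_(t in I01) u t.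

Lemma eq_mean u v : (forall t, I01 t -> u t = v t) -> mean u = mean v.
Proof. by move=> uv; apply: eq_Rintegral => t /set_mem /uv. Qed.

Lemma EFin_mean u : bddmeas u -> ((mean u)%:E = \int[mu]_(t in I01) (u t)%:E)%E.
Proof.
move=> /bddmeas_integrable iu; rewrite /mean /Rintegral fineK//.
by apply: (integrable_fin_num _ iu); exact: measurable_I01.
Qed.

Lemma meanD u v : bddmeas u -> bddmeas v -> mean (fun t => u t + v t) = mean u + mean v.
Proof. by move=> bu bv; rewrite /mean RintegralD//; exact: bddmeas_integrable. Qed.

Lemma meanZ (r : R) u : bddmeas u -> mean (fun t => r * u t) = r * mean u.
Proof. by move=> bu; rewrite /mean RintegralZl//; exact: bddmeas_integrable. Qed.

Lemma mean_cst (r : R) : mean (fun=> r) = r.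
Proof. by rewrite /mean Rintegral_cst//= mu_I01/= mulr1. Qed.

Lemma meanN u : bddmeas u -> mean (fun t => - u t) = - mean u.
Proof.
by move=> bu; rewrite -mulN1r -meanZ//; apply: eq_mean => t _; rewrite mulN1r.
Qed.

Lemma meanB u v : bddmeas u -> bddmeas v -> mean (fun t => u t - v t) = mean u - mean v.
Proof. by move=> bu bv; rewrite meanD ?meanN//; exact: bddmeasN. Qed.

Lemma le_mean u v : bddmeas u -> bddmeas v -> (forall t, I01 t -> u t <= v t) ->
  mean u <= mean v.
Proof. by move=> bu bv uv; apply: le_Rintegral => //; exact: bddmeas_integrable. Qed.

Lemma mean_ge0 u : (forall t, I01 t -> 0 <= u t) -> 0 <= mean u.
Proof. by move=> u0; rewrite /mean; apply: Rintegral_ge0 => t /u0. Qed.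

Lemma mean_sum (I : Type) (r : seq I) (F : I -> R -> R) :
  (forall i, bddmeas (F i)) ->
  bddmeas (fun t => \sum_(i <- r) F i t) /\
  mean (fun t => \sum_(i <- r) F i t) = \sum_(i <- r) mean (F i).
Proof.
move=> bF; elim: r => [|i r [IH1 IH2]].
  under eq_fun do rewrite big_nil.
  by rewrite big_nil mean_cst; split => //; exact: bddmeas_cst.
rewrite big_cons -IH2 -meanD//.
have E : (fun t => \sum_(j <- i :: r) F j t) =
  (fun t => F i t + \sum_(j <- r) F j t) by apply/funext => t; rewrite big_cons.
by rewrite E; split => //; exact: bddmeasD.
Qed.

(** Dominated convergence with a constant majorant, which is integrable because [I01] has measure
    1. *)
Lemma bounded_limit (v_ : nat -> R -> R) u (M : R) :
  (forall k, measurable_fun I01 (v_ k)) ->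
  (forall k t, I01 t -> `|v_ k t| <= M) ->
  (forall t, I01 t -> v_ ^~ t @ \oo --> u t) ->
  bddmeas u /\ mean (v_ k) @[k --> \oo] --> mean u.
Proof.
move=> mv vM vu.
have bv k : bddmeas (v_ k) by split=> //; exists M => t; exact: vM.
have mu_ : measurable_fun I01 u by exact: measurable_fun_cvg vu.
have bu : bddmeas u.
  split=> //; exists M => t It.
  have h : (fun k => `|v_ k t|) @ \oo --> `|u t| by apply: cvg_norm; exact: vu.
  by apply: (ler_cvg_to h (cvg_cst M)); near=> k; exact: vM.
split=> //.
have [] := @dominated_convergence _ _ _ mu I01 measurable_I01
  (fun k => EFin \o v_ k) (EFin \o u) (fun=> M%:E).
- by move=> k; apply/measurable_EFinP; exact: mv.
- by apply/measurable_EFinP; exact: mu_.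
- by apply: aeW => t It; apply/cvg_EFin; [near=> k|exact: vu].
- exact: (bddmeas_integrable (bddmeas_cst M)).
- by apply: aeW => t k It /=; rewrite lee_fin vM.
move=> _ _ h.
have -> : (fun k => mean (v_ k)) =
  fine \o (fun k => (\int[mu]_(x in I01) (EFin \o v_ k) x)%E) by [].
rewrite /mean /Rintegral; apply: fine_cvg.
by rewrite -[X in _ --> X](fineK (integrable_fin_num _ (bddmeas_integrable bu)))// in h.
Unshelve. all: by end_near. Qed.

End BoundedMeasurable.
#[local] Hint Resolve measurable_I01 : core.

(** * Complex-valued functions through their real and imaginary parts *)

Section ComplexValued.
Context {R : realType}.
Local Notation C := R[i].
Local Notation I01 := (@I01 R).
Implicit Types (x y z : C) (v w : R -> C).

Lemma cReD x y : complex.Re (x + y) = complex.Re x + complex.Re y.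
Proof. by case: x y => [? ?] []. Qed.

Lemma cImD x y : complex.Im (x + y) = complex.Im x + complex.Im y.
Proof. by case: x y => [? ?] []. Qed.

Lemma cReN x : complex.Re (- x) = - complex.Re x.
Proof. by case: x. Qed.

Lemma cImN x : complex.Im (- x) = - complex.Im x.
Proof. by case: x. Qed.

Lemma cReM x y : complex.Re (x * y) =
  complex.Re x * complex.Re y - complex.Im x * complex.Im y.
Proof. by case: x y => [? ?] []. Qed.

Lemma cImM x y : complex.Im (x * y) =
  complex.Re x * complex.Im y + complex.Im x * complex.Re y.
Proof. by case: x y => [? ?] []. Qed.

Lemma cRe_sum (I : Type) (r : seq I) (F : I -> C) :
  complex.Re (\sum_(i <- r) F i) = \sum_(i <- r) complex.Re (F i).
Proof. by elim: r => [|i r IH]; rewrite ?big_nil// !big_cons cReD IH. Qed.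

(** The squared modulus as a real polynomial, without a square root, so that identities about it are
    settled by [ring]. *)
Definition sqnormc z : R := complex.Re z ^+ 2 + complex.Im z ^+ 2.

Lemma sqnormc_ge0 z : 0 <= sqnormc z.
Proof. by rewrite addr_ge0 ?sqr_ge0. Qed.

Lemma sqnormcM x y : sqnormc (x * y) = sqnormc x * sqnormc y.
Proof. by rewrite /sqnormc cReM cImM; ring. Qed.

(** Parallelogram law: the difference of the two sides is [sqnormc (x - y)]. *)
Lemma sqnormcD_le x y : sqnormc (x + y) <= 2 * sqnormc x + 2 * sqnormc y.
Proof.
rewrite -subr_ge0 (_ : _ - _ = sqnormc (x - y)) ?sqnormc_ge0//.
by rewrite /sqnormc !(cReD, cImD, cReN, cImN); ring.
Qed.

Lemma sqr_normc z : normc z ^+ 2 = sqnormc z.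
Proof. by case: z => a b; rewrite /= sqr_sqrtr// addr_ge0 ?sqr_ge0. Qed.

Lemma normc_ge0 z : 0 <= normc z.
Proof. by case: z => a b; exact: sqrtr_ge0. Qed.

Lemma normcC z : `|z| = ((normc z)%:C)%C.
Proof. by []. Qed.

Lemma normc_real (r : R) : normc (r%:C)%C = `|r|.
Proof. by rewrite /= expr0n addr0 sqrtr_sqr. Qed.

Lemma Re_le_normc z : `|complex.Re z| <= normc z.
Proof.
by case: z => a b /=; rewrite -sqrtr_sqr ler_wsqrtr// lerDl sqr_ge0.
Qed.

Lemma Im_le_normc z : `|complex.Im z| <= normc z.
Proof.
by case: z => a b /=; rewrite -sqrtr_sqr ler_wsqrtr// lerDr sqr_ge0.
Qed.

Definition cmeas w := measurable_fun I01 (fun t => complex.Re (w t)) /\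
  measurable_fun I01 (fun t => complex.Im (w t)).

Lemma cmeas_cst z : cmeas (fun=> z).
Proof. by split; exact: measurable_cst. Qed.

Lemma cmeasD v w : cmeas v -> cmeas w -> cmeas (fun t => v t + w t).
Proof.
move=> [rv iv] [rw iw]; split.
  by under eq_fun do rewrite cReD; exact: measurable_funD.
by under eq_fun do rewrite cImD; exact: measurable_funD.
Qed.

Lemma cmeasM v w : cmeas v -> cmeas w -> cmeas (fun t => v t * w t).
Proof.
move=> [rv iv] [rw iw]; split.
  under eq_fun do rewrite cReM.
  by apply: measurable_funB; exact: measurable_funM.
under eq_fun do rewrite cImM.
by apply: measurable_funD; exact: measurable_funM.
Qed.

Lemma cmeasN w : cmeas w -> cmeas (fun t => - w t).
Proof.
move=> mw; have := cmeasM (cmeas_cst (-1)) mw.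
by under eq_fun do rewrite mulN1r.
Qed.

Lemma cmeasB v w : cmeas v -> cmeas w -> cmeas (fun t => v t - w t).
Proof. by move=> mv /cmeasN; exact: cmeasD. Qed.

Lemma cmeasX w k : cmeas w -> cmeas (fun t => w t ^+ k).
Proof.
move=> mw; elim: k => [|k IH].
  by under eq_fun do rewrite expr0; exact: cmeas_cst.
by under eq_fun do rewrite exprS; exact: cmeasM.
Qed.

Lemma cmeas_real (u : R -> R) : measurable_fun I01 u -> cmeas (fun t => ((u t)%:C)%C).
Proof. by move=> mu; split => //; exact: measurable_cst. Qed.

Lemma cmeas_normc w : cmeas w -> measurable_fun I01 (fun t => normc (w t)).
Proof.
move=> [rw iw].
have ms : measurable_fun [set: R] (@Num.sqrt R).
  by apply: continuous_measurable_fun; exact: sqrt_continuous.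
have -> : (fun t => normc (w t)) = (@Num.sqrt R) \o (fun t => sqnormc (w t)).
  by apply/funext => t /=; rewrite -sqr_normc sqrtr_sqr ger0_norm ?normc_ge0.
apply: measurableT_comp ms _.
by apply: measurable_funD; exact: measurable_funX.
Qed.

Definition cbddmeas w := bddmeas (fun t => complex.Re (w t)) /\
  bddmeas (fun t => complex.Im (w t)).

Lemma cbddmeasP w (M : R) : cmeas w -> (forall t, I01 t -> normc (w t) <= M) -> cbddmeas w.
Proof.
move=> [rw iw] wM; split; split=> //; exists M => t It.
  exact: le_trans (Re_le_normc _) (wM _ It).
exact: le_trans (Im_le_normc _) (wM _ It).
Qed.

Lemma cbddmeas_cst z : cbddmeas (fun=> z).
Proof. by split; exact: bddmeas_cst. Qed.

Lemma cbddmeas_real (u : R -> R) : bddmeas u -> cbddmeas (fun t => ((u t)%:C)%C).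
Proof. by move=> bu; split => //; exact: bddmeas_cst. Qed.

Lemma cbddmeasD v w : cbddmeas v -> cbddmeas w -> cbddmeas (fun t => v t + w t).
Proof.
move=> [rv iv] [rw iw]; split.
  by under eq_fun do rewrite cReD; exact: bddmeasD.
by under eq_fun do rewrite cImD; exact: bddmeasD.
Qed.

Lemma cbddmeasM v w : cbddmeas v -> cbddmeas w -> cbddmeas (fun t => v t * w t).
Proof.
move=> [rv iv] [rw iw]; split.
  by under eq_fun do rewrite cReM; apply: bddmeasB; exact: bddmeasM.
by under eq_fun do rewrite cImM; apply: bddmeasD; exact: bddmeasM.
Qed.

Lemma cbddmeasB v w : cbddmeas v -> cbddmeas w -> cbddmeas (fun t => v t - w t).
Proof.
move=> bv bw; have := cbddmeasD bv (cbddmeasM (cbddmeas_cst (-1)) bw).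
by under eq_fun do rewrite mulN1r.
Qed.

Lemma cbddmeasX w k : cbddmeas w -> cbddmeas (fun t => w t ^+ k).
Proof.
move=> bw; elim: k => [|k IH].
  by under eq_fun do rewrite expr0; exact: cbddmeas_cst.
by under eq_fun do rewrite exprS; exact: cbddmeasM.
Qed.

Lemma cbddmeas_horner (p : {poly C}) w : cbddmeas w -> cbddmeas (fun t => p.[w t]).
Proof.
move=> bw; elim/poly_ind: p => [|p c IH].
  by under eq_fun do rewrite horner0; exact: cbddmeas_cst.
under eq_fun do rewrite hornerMXaddC.
by apply: cbddmeasD (cbddmeas_cst _); exact: cbddmeasM.
Qed.

Lemma bddmeas_sqnormc w : cbddmeas w -> bddmeas (fun t => sqnormc (w t)).
Proof. by move=> [rw iw]; apply: bddmeasD; exact: bddmeasX. Qed.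

End ComplexValued.

(** * Characters of the circle and trigonometric polynomials *)

Section Circle.
Context {R : realType}.
Local Notation C := R[i].
Local Notation circ := (@circ R).

Lemma circD s t : circ (s + t) = circ s * circ t.
Proof.
apply/eqP; rewrite eq_complex cReM cImM /= !mulrDr cosD sinD.
by rewrite eqxx/= addrC mulrC; apply/eqP; ring.
Qed.

Lemma circ0 : circ 0 = 1.
Proof. by rewrite /Defs.circ mulr0 cos0 sin0. Qed.

Lemma circ1 : circ 1 = 1.
Proof. by rewrite /Defs.circ mulr1 mulr_natl cos2pi sin2pi. Qed.

Lemma circ_natM n t : circ (n%:R * t) = circ t ^+ n.
Proof.
elim: n => [|n IH]; first by rewrite mul0r circ0 expr0.
by rewrite -natr1 mulrDl mul1r circD IH exprSr.
Qed.

Lemma circ_nat n : circ n%:R = 1.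
Proof. by rewrite -[n%:R]mulr1 circ_natM circ1 expr1n. Qed.

Lemma normc_circ t : normc (circ t) = 1.
Proof. by rewrite /= cos2Dsin2 sqrtr1. Qed.

Lemma circ_neq0 t : circ t != 0.
Proof.
by apply/eqP => h; have /eqP := normc_circ t; rewrite h normc0 eq_sym oner_eq0.
Qed.

Lemma circV t : (circ t)^-1 = (circ t)^*%C.
Proof.
apply: (mulfI (circ_neq0 t)); rewrite divff ?circ_neq0//.
apply/eqP; rewrite eq_complex cReM cImM /=.
rewrite mulrN opprK -!expr2 cos2Dsin2 eqxx/= mulrN mulrC.
by rewrite addrC subrr.
Qed.

Lemma cmeas_circ : cmeas circ.
Proof.
split; apply: measurable_funTS; apply: continuous_measurable_fun => t.
  apply: continuous_comp; last exact: continuous_cos.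
  exact: mulrl_continuous.
apply: continuous_comp; last exact: continuous_sin.
exact: mulrl_continuous.
Qed.

Lemma cbddmeas_circ : cbddmeas circ.
Proof. by apply: (cbddmeasP cmeas_circ) => t _; rewrite normc_circ. Qed.

Lemma cbddmeas_circV : cbddmeas (fun t => (circ t)^-1).
Proof.
have [rc ic] := cbddmeas_circ.
by under eq_fun do rewrite circV; split => //; exact: bddmeasN.
Qed.

(** The fundamental theorem of calculus: the antiderivatives [sin (w t) / w] and [- cos (w t) / w]
    take equal values at 0 and 1, as [w] is a nonzero multiple of [2 pi]. *)
Lemma mean_cosine (k : nat) : (0 < k)%N -> mean (fun t : R => cos (2 * pi * (k%:R * t))) = 0
  /\ mean (fun t : R => sin (2 * pi * (k%:R * t))) = 0.
Proof.
move=> k0; set w : R := 2 * pi * k%:R.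
have w0 : w != 0 by rewrite !mulf_neq0// ?pnatr_eq0 -?lt0n// gt_eqF ?pi_gt0.
have E t : 2 * pi * (k%:R * t) = w * t by rewrite mulrA.
have cw0 : cos w = 1 by have := circ_nat k; rewrite /Defs.circ => -[].
have sw0 : sin w = 0 by have := circ_nat k; rewrite /Defs.circ => -[].
have [bcos bsin] : bddmeas (fun t => cos (w * t)) /\ bddmeas (fun t => sin (w * t)).
  have [rc ic] := cbddmeasX k cbddmeas_circ.
  by split; [apply: bddmeas_eq rc|apply: bddmeas_eq ic] => t _;
    rewrite -circ_natM /= E.
have ftc (f F : R -> R) : continuous f -> (forall x : R, is_derive x (1 : R) F (f x)) ->
    bddmeas f -> F 1 = F 0 -> mean f = 0.
  move=> cf dF bf F10.
  have cF : continuous F.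
    move=> x; apply: differentiable_continuous; apply/derivable1_diffP.
    by have [] := dF x.
  rewrite /mean /Defs.I01 Rintegral_itv_bndo_bndc; last first.
    exact: bddmeas_integrable.
  rewrite /Rintegral (@continuous_FTC2 _ f F) ?F10 ?subee//.
  - exact: continuous_subspaceT.
  - split.
    + by move=> x _; have [] := dF x.
    + exact/cvg_at_right_filter/cF.
    + exact/cvg_at_left_filter/cF.
  - by move=> x _; rewrite derive1E; have [] := dF x.
split.
- rewrite (@eq_mean _ _ (fun t => cos (w * t))); last by move=> t _; rewrite E.
  apply: (ftc _ (fun t => w^-1 * sin (w * t))).
  + move=> x; apply: continuous_comp; last exact: continuous_cos.
    exact: mulrl_continuous.
  + move=> x; apply: is_derive_eq.
    by rewrite /GRing.scale/=; field.
  + exact: bcos.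
  + by rewrite mulr0 sin0 mulr1 sw0.
- rewrite (@eq_mean _ _ (fun t => sin (w * t))); last by move=> t _; rewrite E.
  apply: (ftc _ (fun t => - w^-1 * cos (w * t))).
  + move=> x; apply: continuous_comp; last exact: continuous_sin.
    exact: mulrl_continuous.
  + move=> x; apply: is_derive_eq.
    by rewrite /GRing.scale/=; field.
  + exact: bsin.
  + by rewrite mulr0 cos0 mulr1 cw0.
Qed.

Lemma cbddmeas_monomial (c : C) i j : cbddmeas (fun t => c * circ t ^+ i * circ t ^- j).
Proof.
apply: cbddmeasM; first by apply: cbddmeasM (cbddmeas_cst _) _; exact: cbddmeasX cbddmeas_circ.
by under eq_fun do rewrite -exprVn; exact: cbddmeasX cbddmeas_circV.
Qed.

(** Orthogonality of the characters. Complex integrals are never formed: real parts taken with an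
    arbitrary coefficient [c] carry the same information, since [c = 1] and [c = -i] give the real
    and the imaginary part. *)
Lemma mean_monomial (c : C) i j :
  mean (fun t => complex.Re (c * circ t ^+ i * circ t ^- j)) =
  if i == j then complex.Re c else 0.
Proof.
have pos (d : C) k : (0 < k)%N -> mean (fun t => complex.Re (d * circ t ^+ k)) = 0.
  move=> k0; have [ck sk] := mean_cosine k0.
  have [bc bs] := cbddmeasX k cbddmeas_circ.
  rewrite (@eq_mean _ _ (fun t => complex.Re d * complex.Re (circ t ^+ k) -
    complex.Im d * complex.Im (circ t ^+ k))); last by move=> t _; rewrite cReM.
  rewrite meanB; [|exact: bddmeasM (bddmeas_cst _) _|exact: bddmeasM (bddmeas_cst _) _].
  rewrite !meanZ//.
  rewrite (@eq_mean _ (fun t => complex.Re _) (fun t => cos (2 * pi * (k%:R * t)))) ?ck;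
    last by move=> t _; rewrite -circ_natM.
  rewrite (@eq_mean _ (fun t => complex.Im _) (fun t => sin (2 * pi * (k%:R * t)))) ?sk;
    last by move=> t _; rewrite -circ_natM.
  by rewrite !mulr0 subrr.
have [ij|ji|->] := ltngtP i j.
(* A negative power is the conjugate of a positive one, and [Re (c * conj u) = Re (conj c * u)]. *)
- rewrite (@eq_mean _ _ (fun t => complex.Re (c^*%C * circ t ^+ (j - i)))).
    by rewrite pos// subn_gt0.
  move=> t _; rewrite -mulrA.
  have -> : circ t ^+ i * circ t ^- j = (circ t ^+ (j - i))^*%C.
    rewrite -(circ_natM (j - i)) -circV circ_natM.
    rewrite -{1}(subnK (ltnW ij)) exprD invfM mulrCA.
    by rewrite divff ?mulr1// expf_neq0// circ_neq0.
  by rewrite !cReM; case: c (circ t ^+ _) => [? ?] [? ?] /=; ring.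
- rewrite (@eq_mean _ _ (fun t => complex.Re (c * circ t ^+ (i - j)))).
    by rewrite pos// subn_gt0.
  move=> t _; rewrite -mulrA -{1}(subnK (ltnW ji)) exprD mulfK//.
  by rewrite expf_neq0// circ_neq0.
- rewrite (@eq_mean _ _ (fun=> complex.Re c)) ?mean_cst// => t _.
  by rewrite mulfK// expf_neq0// circ_neq0.
Qed.

(** For [n = 1] this reads off a Fourier coefficient. The right-hand side does not depend on [n], so
    integrals of trigonometric polynomials are preserved by [z |-> z^n]. *)
Lemma mean_trigpoly (P : {poly C}) n N : (0 < n)%N ->
  mean (fun t => complex.Re (circ t ^- (n * N) * P.[circ t ^+ n])) =
  complex.Re P`_N.
Proof.
move=> n0.
rewrite (@eq_mean _ _ (fun t => \sum_(i < size P)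
    complex.Re (P`_i * circ t ^+ (n * i) * circ t ^- (n * N)))); last first.
  move=> t _; rewrite horner_coef mulr_sumr cRe_sum; apply: eq_bigr => i _.
  by rewrite -exprM mulrC.
rewrite (mean_sum _ (fun i => (cbddmeas_monomial _ _ _).1)).2.
under eq_bigr do rewrite mean_monomial eqn_pmul2l//.
have [NP|PN] := ltnP N (size P).
  rewrite (bigD1 (Ordinal NP))//= eqxx big1 ?addr0// => i /negbTE iN.
  by rewrite ifF//; apply: contraFF iN => /eqP iN; apply/eqP/val_inj.
rewrite nth_default// big1// => i _; rewrite ifF//.
by apply/negbTE; rewrite neq_ltn (leq_trans (ltn_ord i) PN).
Qed.

(** Laurent polynomials in [circ t], encoded as a polynomial over a single power, which avoids sums
    over two-sided index ranges. *)
Definition trigpoly (q : R -> C) := exists N (P : {poly C}),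
  forall t, q t = circ t ^- N * P.[circ t].

Lemma trigpoly_cst c : trigpoly (fun=> c).
Proof. by exists 0%N, c%:P => t; rewrite hornerC expr0 invr1 mul1r. Qed.

Lemma trigpoly_circ : trigpoly circ.
Proof. by exists 0%N, 'X => t; rewrite hornerX expr0 invr1 mul1r. Qed.

Lemma trigpoly_circV : trigpoly (fun t => (circ t)^-1).
Proof. by exists 1%N, 1 => t; rewrite hornerC expr1 mulr1. Qed.

Lemma trigpolyM p q : trigpoly p -> trigpoly q -> trigpoly (fun t => p t * q t).
Proof.
move=> [N [P pP]] [M [Q qQ]]; exists (N + M)%N, (P * Q) => t.
by rewrite pP qQ hornerM exprD invfM mulrACA.
Qed.

Lemma trigpolyD p q : trigpoly p -> trigpoly q -> trigpoly (fun t => p t + q t).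
Proof.
move=> [N [P pP]] [M [Q qQ]]; exists (N + M)%N, ('X^M * P + 'X^N * Q) => t.
have h k : circ t ^+ k != 0 by rewrite expf_neq0// circ_neq0.
rewrite pP qQ hornerD !hornerM !hornerXn exprD invfM mulrDr.
by congr (_ + _); field; rewrite !h.
Qed.

Lemma cbddmeas_trigpoly q : trigpoly q -> cbddmeas q.
Proof.
move=> [N [P qP]].
have -> : q = (fun t => (circ t)^-1 ^+ N * P.[circ t]).
  by apply/funext => t; rewrite qP exprVn.
apply: cbddmeasM; first exact: cbddmeasX cbddmeas_circV.
exact: cbddmeas_horner cbddmeas_circ.
Qed.

End Circle.

(** * Polynomial approximation of the sign function *)

Section Sigmoid.
Context {R : realType}.
Implicit Type x : R.

(** An odd cubic with fixed points -1, 0 and 1 whose derivative vanishes at the outer two. Being a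
    polynomial, it maps trigonometric polynomials to trigonometric polynomials. *)
Definition sigmoid x : R := x * (3 - x * x) / 2.

(** The double roots of [sigmoid y + 1] at -1 and of [1 - sigmoid y] at 1 show that [[-1, 1]] is
    mapped into itself. *)
Lemma sigmoid_bound k x : `|x| <= 1 -> `|iter k sigmoid x| <= 1.
Proof.
move=> x1; elim: k => //= k; set y := iter k _ _ => y1.
move: y1; rewrite !ler_norml => /andP[ym yp].
rewrite -[- 1 <= _]subr_ge0 -[_ <= 1]subr_ge0.
have -> : sigmoid y - -1 = (1 + y) ^+ 2 * (2 - y) / 2 by rewrite /sigmoid; field.
have -> : 1 - sigmoid y = (1 - y) ^+ 2 * (2 + y) / 2 by rewrite /sigmoid; field.
by apply/andP; split; rewrite divr_ge0// mulr_ge0 ?sqr_ge0//; lra.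
Qed.

Lemma iter_sigmoidN k x : iter k sigmoid (- x) = - iter k sigmoid x.
Proof. by elim: k => //= k ->; rewrite /sigmoid; field. Qed.

(** The distance [a] to the fixed point 1 becomes [a * (a (3 - a) / 2)]. The second factor increases
    with [a] on [[0, 1]], so it stays below its initial value [r < 1], and the decay is
    geometric. *)
Lemma cvg_sigmoid_pos x : 0 < x -> x <= 1 -> iter k sigmoid x @[k --> \oo] --> (1 : R).
Proof.
move=> x0 x1; set y := 1 - x; set r := y * (3 - y) / 2.
have y0 : 0 <= y by rewrite subr_ge0.
have y1 : y < 1 by rewrite /y; lra.
have r0 : 0 <= r by rewrite /r; nra.
have r1 : r < 1 by rewrite /r; nra.
have bnd k : 0 <= 1 - iter k sigmoid x /\ 1 - iter k sigmoid x <= y * r ^+ k.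
  elim: k => [|k [IH0 IH1]] /=; first by rewrite expr0 mulr1.
  set a := 1 - iter k sigmoid x in IH0 IH1.
  have -> : 1 - sigmoid (iter k sigmoid x) = a * (a * (3 - a) / 2).
    by rewrite /sigmoid /a; field.
  have ay : a <= y.
    by rewrite (le_trans IH1)// ler_piMr// exprn_ile1// ltW.
  have ar : a * (3 - a) / 2 <= r by rewrite /r; nra.
  have a0 : 0 <= a * (3 - a) / 2 by nra.
  split; first by rewrite mulr_ge0.
  by rewrite exprSr [leRHS]mulrA; apply: ler_pM.
have h : (fun k => 1 - iter k sigmoid x) @ \oo --> (0 : R).
  apply: (@squeeze_cvgr _ _ _ _ (fun=> 0) (fun k => y * r ^+ k)).
  - by near=> k; have [-> ->] := bnd k.
  - exact: cvg_cst.
  - rewrite -[X in _ --> X](mulr0 y); apply: cvgM; first exact: cvg_cst.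
    by apply: cvg_expr; rewrite ger0_norm.
have -> : (fun k => iter k sigmoid x) =
    (fun=> 1) \- (fun k => 1 - iter k sigmoid x).
  by apply/funext => k /=; rewrite subKr.
by rewrite -[X in _ --> X](subr0 1); exact: cvgB (cvg_cst _) h.
Unshelve. all: by end_near. Qed.

Lemma cvg_sigmoid x : `|x| <= 1 -> iter k sigmoid x @[k --> \oo] --> Num.sg x.
Proof.
rewrite ler_norml => /andP[xm xp].
have [->|x0|x0] := sgrP x.
- rewrite (_ : (fun k => _) = fun=> 0); first exact: cvg_cst.
  by apply/funext; elim=> //= k ->; rewrite /sigmoid !mul0r.
- exact: cvg_sigmoid_pos.
- have h : iter k sigmoid (- x) @[k --> \oo] --> (1 : R).
    by apply: cvg_sigmoid_pos; lra.
  have -> : (fun k => iter k sigmoid x) = \- (fun k => iter k sigmoid (- x)).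
    by apply/funext => k /=; rewrite iter_sigmoidN opprK.
  exact: cvgN h.
Qed.

End Sigmoid.

(** * A monotone class theorem generated by trigonometric polynomials *)

Section MonotoneClass.
Context {R : realType}.
Local Notation C := R[i].
Local Notation I01 := (@I01 R).

Lemma trigpoly_eq (p q : R -> C) : p =1 q -> trigpoly p -> trigpoly q.
Proof. by move=> /funext ->. Qed.

Definition trigreal (q : R -> R) := trigpoly (fun t => ((q t)%:C)%C).

Lemma trigreal_cst r : trigreal (fun=> r).
Proof. exact: trigpoly_cst. Qed.

Lemma trigrealD p q : trigreal p -> trigreal q -> trigreal (fun t => p t + q t).
Proof.
move=> tp tq; rewrite /trigreal; under eq_fun do rewrite rmorphD.
exact: trigpolyD.
Qed.

Lemma trigrealM p q : trigreal p -> trigreal q -> trigreal (fun t => p t * q t).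
Proof.
move=> tp tq; rewrite /trigreal; under eq_fun do rewrite rmorphM.
exact: trigpolyM.
Qed.

Lemma trigrealB p q : trigreal p -> trigreal q -> trigreal (fun t => p t - q t).
Proof.
move=> tp tq; have := trigrealD tp (trigrealM (trigreal_cst (-1)) tq).
by under eq_fun do rewrite mulN1r.
Qed.

Lemma trigreal_cos : trigreal (fun t => cos (2 * pi * t)).
Proof.
apply: trigpoly_eq (trigpolyM (trigpoly_cst (2^-1%:C)%C)
  (trigpolyD trigpoly_circ trigpoly_circV)) => t; rewrite circV.
by apply/eqP; rewrite eq_complex /=; apply/andP; split; apply/eqP; field.
Qed.

Lemma trigreal_sin : trigreal (fun t => sin (2 * pi * t)).
Proof.
apply: trigpoly_eq (trigpolyM (trigpoly_cst (Complex 0 (- 2^-1)))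
  (trigpolyD trigpoly_circ (trigpolyM (trigpoly_cst (-1)) trigpoly_circV))) => t.
rewrite circV.
by apply/eqP; rewrite eq_complex /=; apply/andP; split; apply/eqP; field.
Qed.

(** The factor [sin (pi (t - x))] changes sign at [x] but is not 1-periodic. Multiplying by
    [sin (pi t)], which is nonnegative on [I01], makes it so: the product is half of
    [cos (pi x) - cos (2 pi t - pi x)]. *)
Definition arc (x t : R) : R := sin (pi * t) * sin (pi * (t - x)).

Lemma trigreal_arc x : trigreal (arc x).
Proof.
have -> : arc x = fun t => 2^-1 * (cos (pi * x) -
    (cos (2 * pi * t) * cos (pi * x) + sin (2 * pi * t) * sin (pi * x))).
  apply/funext => t; rewrite -cosB.
  have -> : 2 * pi * t - pi * x = pi * t + pi * (t - x) by ring.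
  have -> : pi * x = pi * t - pi * (t - x) by ring.
  rewrite cosB cosD.
  by rewrite /arc; field.
apply: trigrealM (trigreal_cst _) _; apply: trigrealB (trigreal_cst _) _.
by apply: trigrealD; apply: trigrealM (trigreal_cst _);
  [exact: trigreal_cos|exact: trigreal_sin].
Qed.

Lemma arc_gt0 (x t : R) : 0 <= x -> x < 1 -> I01 t -> (0 < arc x t) = (x < t).
Proof.
move=> x0 x1; rewrite /Defs.I01 /= in_itv/= => /andP[t0 t1].
have p0 := @pi_gt0 R.
have spos (y : R) : 0 < y < 1 -> 0 < sin (pi * y).
  by move=> /andP[y0 y1]; apply: sin_gt0_pi; rewrite mulr_gt0//= gtr_pMr.
have [xt|tx] := ltP x t.
  apply: mulr_gt0; apply: spos; first by rewrite (le_lt_trans x0).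
  by apply/andP; split; lra.
apply/negbTE; rewrite -leNgt /arc.
move: t0; rewrite le_eqVlt => /predU1P[<-|t0]; first by rewrite mulr0 sin0 mul0r.
rewrite pmulr_rle0 ?spos ?t0//.
move: tx; rewrite le_eqVlt => /predU1P[->|tx]; first by rewrite subrr mulr0 sin0.
rewrite -opprB mulrN sinN oppr_le0 ltW// spos//.
by apply/andP; split; lra.
Qed.

Lemma norm_arc x t : `|arc x t| <= 1.
Proof.
by rewrite normrM mulr_ile1// ler_norml ?sin_geN1 ?sin_le1.
Qed.

(** [S] stands for a property to be established for all bounded measurable functions. The three
    closure conditions are those that identities between integrals and approximation in mean
    satisfy. *)
Variable S : set (R -> R).
Hypothesis S_trig : forall q, trigreal q -> S q.
Hypothesis S_lin : forall (a : R) u v, S u -> S v -> S (fun t => a * u t + v t).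
Hypothesis S_lim : forall (v_ : nat -> R -> R) (u : R -> R) (M : R), (forall k, S (v_ k)) ->
  (forall k t, I01 t -> `|v_ k t| <= M) ->
  (forall t, I01 t -> v_ ^~ t @ \oo --> u t) -> S u.

Let S_cst r : S (fun=> r).
Proof. exact/S_trig/trigreal_cst. Qed.

(** A constant sequence suffices: limits are only tested on [I01], so values outside may be changed
    freely. *)
Let S_eq u v (M : R) : S u -> (forall t, I01 t -> `|u t| <= M) ->
  (forall t, I01 t -> u t = v t) -> S v.
Proof.
move=> Su uM uv; apply: (S_lim (v_ := fun=> u)) => // [k t It|t It].
  exact: uM.
by rewrite -uv//; exact: cvg_cst.
Qed.

Let S_arc (x : R) : 0 <= x -> x < 1 -> S (\1_(`]x, +oo[%classic)).
Proof.
move=> x0 x1.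
pose g k t := iter k sigmoid (arc x t).
(* The map [s |-> (s + s^2) / 2] sends 1 to 1 and both 0 and -1 to 0, which turns the limiting sign
   of [arc x t] into the indicator of [x < t]. *)
apply: (S_lim (v_ := fun k t => 2^-1 * (g k t + g k t * g k t)) (M := 1)).
- move=> k; apply: S_trig; apply: trigrealM (trigreal_cst _) _.
  have tg : trigreal (g k).
    rewrite /g; elim: k => [|k IH] /=; first exact: trigreal_arc.
    apply: trigrealM (trigreal_cst _); apply: (trigrealM IH).
    by apply: trigrealB (trigreal_cst _) _; exact: (trigrealM IH IH).
  by apply: (trigrealD tg); exact: (trigrealM tg tg).
- move=> k t It; have := sigmoid_bound k (norm_arc x t); rewrite -/(g k t).
  by rewrite !ler_norml => /andP[g0 g1]; apply/andP; split; nra.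
- move=> t It; have h := cvg_sigmoid (norm_arc x t).
  have -> : \1_(`]x, +oo[%classic) t = 2^-1 * (Num.sg (arc x t) +
      Num.sg (arc x t) * Num.sg (arc x t)) :> R.
    rewrite indicE mem_setE/= in_itv/= andbT -arc_gt0//.
    by have [||] := sgrP (arc x t) => /= _; field.
  by apply: cvgM; [exact: cvg_cst|apply: cvgD => //; exact: cvgM].
Qed.

(** By disjointness the partial sum is the indicator of a finite union, hence bounded by 1 whatever
    [n] is. *)
Let sum_indic (F : (set R)^nat) n t : trivIset setT F ->
  \sum_(i < n) \1_(F i) t = (`[< exists i, (i < n)%N /\ F i t >])%:R :> R.
Proof.
move=> tF; elim: n => [|n IH].
  by rewrite big_ord0; case: asboolP => // -[i []].
rewrite big_ord_recr/= IH indicE.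
have [Fn|nFn] := pselect (F n t).
  rewrite (mem_set Fn) asboolF ?add0r ?asboolT//; first by exists n.
  move=> [i [iin Fi]]; have := tF i n I I (ex_intro _ t (conj Fi Fn)).
  by move=> iE; rewrite iE ltnn in iin.
rewrite (memNset nFn) addr0; congr ((nat_of_bool _)%:R).
apply: asbool_equiv_eq; split.
  by move=> [i [iin Fi]]; exists i; split => //; exact: ltnW.
move=> [i [iin Fi]]; exists i; split=> //.
by move: iin; rewrite ltnS leq_eqVlt => /predU1P[iE|//]; rewrite iE in Fi.
Qed.

(** Dynkin's theorem on the pi-system of open right rays. Rays starting in [[0, 1[] come from
    [S_arc]; all others contain [I01] or miss it. *)
Let S_indic (E : set R) : measurable E -> S (\1_E).
Proof.
move: E; have mE := RGenOInfty.measurableE R.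
move=> E mEE; have {mEE} : <<s @RGenOInfty.G R >> E by rewrite -[<<s _ >>]mE.
move: E; apply: (@dynkin_induction _ R (@RGenOInfty.G R) (fun E => S \1_E)).
- exact: mE.
- move=> _ _ [x ->] [y ->]; exists (Num.max x y).
  by apply/seteqP; split=> t /=; rewrite !in_itv/= !andbT gt_max => /andP.
- by apply: (S_eq (S_cst 1) (M := 1)) => t _; rewrite ?normr1// indicT.
- move=> _ [x ->]; have [x0|x0] := ltP x 0.
    apply: (S_eq (S_cst 1) (M := 1)) => t; rewrite ?normr1//.
    rewrite /Defs.I01/= in_itv/= => /andP[t0 t1].
    by rewrite indicE mem_set//= in_itv/= andbT (lt_le_trans x0).
  have [x1|x1] := ltP x 1; first exact: S_arc.
  apply: (S_eq (S_cst 0) (M := 1)) => t; rewrite ?normr0//.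
  rewrite /Defs.I01/= in_itv/= => /andP[t0 t1].
  by rewrite indicE memNset//= in_itv/= andbT; apply/negP; rewrite -leNgt; lra.
- move=> E _ SE.
  apply: (S_eq (S_lin (-1) SE (S_cst 1)) (M := 1)) => t _; rewrite !indicE ?in_setC;
    by case: (t \in E); rewrite /= ?mulr1 ?mulr0 ?addNr ?add0r ?normr0 ?normr1.
- move=> F _ tF SF.
  apply: (S_lim (v_ := fun n t => \sum_(i < n) \1_(F i) t) (M := 1)).
  + elim=> [|n IH].
      rewrite (_ : (fun t => _) = fun=> 0) //; by apply/funext => t; rewrite big_ord0.
    rewrite (_ : (fun t => _) =
      fun t => 1 * (\sum_(i < n) \1_(F i) t) + \1_(F n) t); first exact: S_lin.
    by apply/funext => t; rewrite big_ord_recr/= mul1r.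
  + by move=> n t _; rewrite sum_indic//; case: asboolP; rewrite ?normr1 ?normr0.
  + move=> t _; have [[i _ Fi]|nF] := pselect ((\bigcup_k F k) t).
      rewrite indicE mem_set; last by exists i.
      apply: cvg_near_cst; exists i.+1 => // n /= ni.
      by rewrite sum_indic// asboolT//; exists i.
    rewrite indicE memNset//; apply: cvg_near_cst; near=> n.
    rewrite sum_indic// asboolF// => -[i [_ Fi]]; apply: nF.
    by exists i.
Unshelve. all: by end_near. Qed.

(** Binary expansion: subtracting [m / 2] where [u] is at least [m / 2] leaves a function with
    values in [[0, m / 2]], to which the induction hypothesis applies. *)
Let S_halving k : forall (u : R -> R) (m : R), measurable_fun I01 u ->
  (forall t, I01 t -> 0 <= u t <= m) ->
  exists2 v, S v & forall t, I01 t -> 0 <= u t - v t <= m / 2 ^+ k.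
Proof.
elim: k => [|k IH] u m mu um.
  exists (fun=> 0); first exact: S_cst.
  by move=> t It; rewrite subr0 expr0 divr1 um.
pose E := I01 `&` u @^-1` `[m / 2, +oo[.
have mE : measurable E by apply: mu; [exact: measurable_I01|exact: measurable_itv].
have EE t : I01 t -> \1_E t = (m / 2 <= u t)%R%:R :> R.
  move=> It; rewrite indicE; congr ((nat_of_bool _)%:R); apply/idP/idP.
    by rewrite inE => -[_ /=]; rewrite in_itv/= andbT.
  by move=> h; rewrite inE; split => //=; rewrite in_itv/= andbT.
have [||v Sv uv] := IH (fun t => u t - m / 2 * \1_E t) (m / 2).
- apply: measurable_funB => //; apply: measurable_funM; first exact: measurable_cst.
  exact: measurable_indic.
- move=> t It; rewrite EE//; have /andP[u0 u1] := um _ It.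
  by case: (leP (m / 2) (u t)) => h /=; apply/andP; split; lra.
exists (fun t => m / 2 * \1_E t + v t); first by apply: S_lin => //; exact: S_indic.
by move=> t It; rewrite opprD addrA exprS invfM mulrA uv.
Qed.

Theorem trig_monotone_class u : bddmeas u -> S u.
Proof.
move=> [mu [M uM]].
(* Adding [M] moves the values of [u] into [[0, 2 M]], as [S_halving] requires. *)
have h k : exists v, S v /\ forall t, I01 t ->
    0 <= u t + M - v t <= (M + M) / 2 ^+ k.
  have [||v Sv uv] := S_halving k (u := fun t => u t + M) (m := M + M).
  - by apply: measurable_funD => //; exact: measurable_cst.
  - move=> t /uM; rewrite ler_norml => /andP[? ?].
    by apply/andP; split; lra.
  by exists v.
have [v_ vP] := choice h.
have M0 : 0 <= M.
  by apply: le_trans (uM 0 _) => //; rewrite /Defs.I01/= in_itv/= lexx ltr01.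
(* The approximant is [u] minus an error in [[0, 2 M]], whence the uniform bound [3 M]. *)
apply: (S_lim (v_ := fun k t => 1 * v_ k t + - M) (M := 3 * M)).
- by move=> k; apply: S_lin; [exact: (vP k).1|exact: S_cst].
- move=> k t It; have /andP[a b] := (vP k).2 _ It.
  have c : (M + M) / 2 ^+ k <= M + M.
    rewrite ler_pdivrMr ?exprn_gt0// ler_peMr ?addr_ge0// exprn_ege1//.
    by rewrite ler1n.
  have := uM _ It; rewrite !ler_norml => /andP[d e].
  by apply/andP; split; lra.
- move=> t It.
  have g : (fun k => u t - (1 * v_ k t + - M)) @ \oo --> (0 : R).
    apply: (@squeeze_cvgr _ _ _ _ (fun=> 0) (fun k => (M + M) * (2^-1) ^+ k)).
    - near=> k; have /andP[a b] := (vP k).2 _ It; rewrite exprVn.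
      by apply/andP; split; lra.
    - exact: cvg_cst.
    - rewrite -[X in _ --> X](mulr0 (M + M)); apply: cvgM; first exact: cvg_cst.
      by apply: cvg_expr; rewrite ger0_norm ?invr_ge0// invf_lt1 ?ltr1n.
  have -> : (fun k => 1 * v_ k t + - M) =
      (fun=> u t) \- (fun k => u t - (1 * v_ k t + - M)).
    by apply/funext => k /=; rewrite subKr.
  by rewrite -[X in _ --> X](subr0 (u t)); exact: cvgB (cvg_cst _) g.
Unshelve. all: by end_near. Qed.

End MonotoneClass.

(** * Density in mean square, and bounded functions with vanishing negative Fourier coefficients *)

Section L2Density.
Context {R : realType}.
Local Notation C := R[i].
Local Notation I01 := (@I01 R).
Local Notation circ := (@circ R).
Implicit Types (v w : R -> C).

(** The square of the [L^2] distance, with no root taken; hence the factors 2 in the triangle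
    inequalities below. *)
Definition l2dist v w : R := mean (fun t => sqnormc (v t - w t)).

Lemma l2dist_triangle u v w : cbddmeas u -> cbddmeas v -> cbddmeas w ->
  l2dist u w <= 2 * l2dist u v + 2 * l2dist v w.
Proof.
move=> bu bv bw.
have buv := bddmeas_sqnormc (cbddmeasB bu bv); have bvw := bddmeas_sqnormc (cbddmeasB bv bw).
have c2 := @bddmeas_cst R 2.
rewrite /l2dist -!meanZ// -meanD; [|exact: (bddmeasM c2)|exact: (bddmeasM c2)].
apply: le_mean; first exact: bddmeas_sqnormc (cbddmeasB bu bw).
  by apply: bddmeasD; apply: bddmeasM.
by move=> t _; rewrite -(subrKA (v t)) sqnormcD_le.
Qed.

Lemma l2distM_le c v w (K : R) : cbddmeas c -> cbddmeas v -> cbddmeas w -> 0 <= K ->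
  (forall t, I01 t -> sqnormc (c t) <= K) ->
  l2dist (fun t => c t * v t) (fun t => c t * w t) <= K * l2dist v w.
Proof.
move=> bc bv bw K0 cK; have bvw := bddmeas_sqnormc (cbddmeasB bv bw).
rewrite -meanZ//; apply: le_mean.
- by apply: bddmeas_sqnormc; apply: cbddmeasB; exact: cbddmeasM.
- exact: bddmeasM (bddmeas_cst _) _.
- by move=> t It; rewrite -mulrBr sqnormcM ler_wpM2r ?sqnormc_ge0// cK.
Qed.

Lemma l2distD_le v1 v2 w1 w2 : cbddmeas v1 -> cbddmeas v2 -> cbddmeas w1 -> cbddmeas w2 ->
  l2dist (fun t => v1 t + v2 t) (fun t => w1 t + w2 t) <=
    2 * l2dist v1 w1 + 2 * l2dist v2 w2.
Proof.
move=> b1 b2 b3 b4.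
have b13 := bddmeas_sqnormc (cbddmeasB b1 b3); have b24 := bddmeas_sqnormc (cbddmeasB b2 b4).
have c2 := @bddmeas_cst R 2.
rewrite /l2dist -!meanZ// -meanD; [|exact: (bddmeasM c2)|exact: (bddmeasM c2)].
apply: le_mean.
- by apply: bddmeas_sqnormc; apply: cbddmeasB; exact: cbddmeasD.
- by apply: bddmeasD; apply: bddmeasM.
- by move=> t _; rewrite opprD addrACA sqnormcD_le.
Qed.

Definition trig_approx w := forall e : R, 0 < e ->
  exists2 q, trigpoly q & l2dist w q < e.

Lemma trig_approx_lin c v w : cbddmeas v -> cbddmeas w -> trig_approx v -> trig_approx w ->
  trig_approx (fun t => c * v t + w t).
Proof.
(* The added 1 keeps [K] positive when [c = 0], so that dividing by it is legitimate. *)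
move=> bv bw av aw e e0; set K := sqnormc c + 1.
have K0 : 0 < K by rewrite ltr_wpDl ?sqnormc_ge0.
have [|p tp vp] := av (e / 4 / K); first by rewrite !divr_gt0.
have [|q tq wq] := aw (e / 4); first by rewrite divr_gt0.
exists (fun t => c * p t + q t).
  by apply: trigpolyD => //; exact: trigpolyM (trigpoly_cst _) _.
have bp := cbddmeas_trigpoly tp; have bq := cbddmeas_trigpoly tq.
have bc := cbddmeas_cst c.
apply: le_lt_trans (l2distD_le (cbddmeasM bc bv) bw (cbddmeasM bc bp) bq) _.
have : l2dist (fun t => c * v t) (fun t => c * p t) <= K * l2dist v p.
  by apply: l2distM_le => //; [exact: ltW|move=> t _; rewrite lerDl].
move: vp; rewrite ltr_pdivlMr// [_ * K]mulrC => vp h; lra.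
Qed.

(** Monotone class argument. For the closure under bounded limits, [(w - v_k)^2] is bounded by
    [(N + M)^2] and tends to 0, so [v_k] tends to [w] in mean square. *)
Lemma trig_approx_real (u : R -> R) : bddmeas u -> trig_approx (fun t => ((u t)%:C)%C).
Proof.
move=> bu; suff [] : bddmeas u /\ trig_approx (fun t => ((u t)%:C)%C) by [].
pose S (u : R -> R) := bddmeas u /\ trig_approx (fun t => ((u t)%:C)%C).
apply: (@trig_monotone_class R S) => // [q tq|a u1 u2 [b1 s1] [b2 s2]|v_ w M Sv vM vw].
- split; first by have [] := cbddmeas_trigpoly tq.
  move=> e e0; exists (fun t => ((q t)%:C)%C) => //.
  by rewrite /l2dist (@eq_mean _ _ (fun=> 0)) ?mean_cst// => t _;
    rewrite subrr /sqnormc/= expr0n addr0.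
- split; first by apply: bddmeasD => //; exact: bddmeasM (bddmeas_cst _) _.
  have := trig_approx_lin (a%:C)%C (cbddmeas_real b1) (cbddmeas_real b2) s1 s2.
  by under eq_fun do rewrite -rmorphM -rmorphD.
- have [bw _] := bounded_limit (fun k => (Sv k).1.1) vM vw.
  split=> // e e0; have [N wN] := bw.2.
  have [|||_ h] := @bounded_limit _ (fun k t => (w t - v_ k t) ^+ 2) (fun=> 0)
    ((N + M) ^+ 2).
  + by move=> k; apply: (bddmeasX 2 (bddmeasB bw (Sv k).1)).1.
  + move=> k t It; rewrite normrX lerXn2r// ?nnegrE//.
      by rewrite addr_ge0// ?(le_trans _ (wN _ It))// (le_trans _ (vM 0%N _ It)).
    by rewrite (le_trans (ler_normB _ _))// lerD ?wN ?vM.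
  + move=> t It; rewrite (_ : (fun k => _) =
      ((fun=> w t) \- (v_ ^~ t)) \* ((fun=> w t) \- (v_ ^~ t))); last first.
      by apply/funext => k /=; rewrite expr2.
    rewrite [X in _ --> X](_ : _ = (w t - w t) * (w t - w t)); last first.
      by rewrite subrr mulr0.
    by apply: cvgM; apply: cvgB (cvg_cst _) _; exact: vw.
  rewrite mean_cst in h.
  have e4 : 0 < e / 4 by rewrite divr_gt0.
  have /cvgrPdist_lt /(_ _ e4) [k _ /(_ k (leqnn k))] := h.
  rewrite /= sub0r normrN => hk.
  have [q tq vq] := (Sv k).2 _ e4.
  exists q => //.
  apply: le_lt_trans (l2dist_triangle (cbddmeas_real bw) (cbddmeas_real (Sv k).1)
    (cbddmeas_trigpoly tq)) _.
  have : l2dist (fun t => ((w t)%:C)%C) (fun t => ((v_ k t)%:C)%C) < e / 4.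
    apply: le_lt_trans hk; rewrite (le_trans _ (ler_norm _))//.
    rewrite /l2dist (@eq_mean _ _ (fun t => (w t - v_ k t) ^+ 2))// => t _.
    by rewrite /sqnormc cReD cImD cReN cImN/= subr0 expr0n addr0.
  by move=> h1; lra.
Qed.

Theorem trig_dense w : cbddmeas w -> trig_approx w.
Proof.
move=> [rw iw].
have -> : w = fun t => Complex 0 1 * ((complex.Im (w t))%:C)%C + ((complex.Re (w t))%:C)%C.
  apply/funext => t; case: (w t) => a b; apply/eqP.
  by rewrite eq_complex /=; apply/andP; split; apply/eqP; ring.
exact: (trig_approx_lin (Complex 0 1) (cbddmeas_real iw) (cbddmeas_real rw)
  (trig_approx_real iw) (trig_approx_real rw)).
Qed.

(* [|Re z| <= (|z|^2 / d + d) / 2], integrated and applied with [|z|^2] of mean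
   at most [d ^+ 2]. *)
Lemma mean_eq0_limit w : cbddmeas w ->
  (forall e : R, 0 < e -> exists v, [/\ cbddmeas v,
     mean (fun t => complex.Re (v t)) = 0 & l2dist w v < e]) ->
  mean (fun t => complex.Re (w t)) = 0.
Proof.
move=> bw h; apply/eqP; rewrite -normr_le0; apply/ler_addgt0Pr => d d0; rewrite add0r.
have [|v [bv v0 wv]] := h (d ^+ 2); first by rewrite exprn_gt0.
have bwv := cbddmeasB bw bv; have bn := bddmeas_sqnormc bwv.
have -> : mean (fun t => complex.Re (w t)) = mean (fun t => complex.Re (w t - v t)).
  rewrite (@eq_mean _ (fun t => complex.Re (w t - v t))
    (fun t => complex.Re (w t) - complex.Re (v t))).
    by rewrite meanB ?v0 ?subr0; [|exact: bw.1|exact: bv.1].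
  by move=> t _; rewrite cReD cReN.
(* The signs [s = 1] and [s = -1] together bound the absolute value; the pointwise estimate is the
   square [(Re z - s d)^2 + (Im z)^2] being nonnegative. *)
have key (s : R) : s ^+ 2 = 1 -> s * mean (fun t => complex.Re (w t - v t)) <= d.
  move=> s1; rewrite -meanZ; last exact: bwv.1.
  apply: (@le_trans _ _ (mean (fun t => (2 * d)^-1 * sqnormc (w t - v t) + d / 2))).
    apply: le_mean.
    - exact: bddmeasM (bddmeas_cst _) bwv.1.
    - by apply: bddmeasD (bddmeas_cst _); exact: bddmeasM (bddmeas_cst _) _.
    move=> t _; set z := w t - v t.
    rewrite -subr_ge0 (_ : _ - _ = (2 * d)^-1 *
      ((complex.Re z - s * d) ^+ 2 + complex.Im z ^+ 2)).
      by rewrite mulr_ge0 ?addr_ge0 ?sqr_ge0// invr_ge0 mulr_ge0// ltW.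
    rewrite sqrrB exprMn s1 mul1r /sqnormc; field; exact: lt0r_neq0.
  rewrite meanD ?mean_cst ?meanZ//; [|exact: bddmeasM (bddmeas_cst _) _|exact: bddmeas_cst].
  rewrite -/(l2dist w v).
  have : (2 * d)^-1 * l2dist w v <= (2 * d)^-1 * d ^+ 2.
    by rewrite ler_wpM2l ?(ltW wv)// invr_ge0 mulr_ge0// ltW.
  have -> : (2 * d)^-1 * d ^+ 2 = d / 2 by field; exact: lt0r_neq0.
  lra.
have := key 1 (expr1n _ _); have := key (-1); rewrite sqrrN expr1n => /(_ erefl).
by rewrite ler_norml; lra.
Qed.

(** The counterpart of [Hinf] on the parameter interval for functions bounded everywhere; the free
    coefficient [c] covers real and imaginary parts at once. *)
Definition hardy w := cbddmeas w /\ forall k (c : C), (0 < k)%N ->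
  mean (fun t => complex.Re (c * w t * circ t ^+ k)) = 0.

Lemma hardyB v w : hardy v -> hardy w -> hardy (fun t => v t - w t).
Proof.
move=> [bv v0] [bw w0]; split=> [|k c k0]; first exact: cbddmeasB.
rewrite (@eq_mean _ _ (fun t => complex.Re (c * v t * circ t ^+ k) -
    complex.Re (c * w t * circ t ^+ k))).
  have b u : cbddmeas u -> bddmeas (fun t => complex.Re (c * u t * circ t ^+ k)).
    move=> bu; have [] // : cbddmeas (fun t => c * u t * circ t ^+ k).
    by apply: cbddmeasM; [exact: cbddmeasM (cbddmeas_cst _) _|exact: cbddmeasX cbddmeas_circ].
  by rewrite meanB ?v0 ?w0 ?subrr//; exact: b.
by move=> t _; rewrite -cReN -cReD mulrBr mulrBl.
Qed.

Lemma hardy_poly (P : {poly C}) : hardy (fun t => P.[circ t]).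
Proof.
split; first exact: cbddmeas_horner cbddmeas_circ.
move=> k c k0.
have := mean_trigpoly (c%:P * P * 'X^k) 0 (ltn0Sn 0).
rewrite coefMXn k0 => /= h; rewrite -[RHS]h; apply: eq_mean => t _.
by rewrite muln0 expr0 invr1 mul1r expr1 !hornerE.
Qed.

(** Expanding [P] only raises the positive exponent [k] to [i + k]. *)
Lemma hardy_mul_poly w (P : {poly C}) k (c : C) : hardy w -> (0 < k)%N ->
  mean (fun t => complex.Re (c * (w t * P.[circ t]) * circ t ^+ k)) = 0.
Proof.
move=> [bw w0] k0.
rewrite (@eq_mean _ _ (fun t => \sum_(i < size P)
    complex.Re (c * P`_i * w t * circ t ^+ (i + k)))).
  rewrite (mean_sum _ _).2.
    by rewrite big1// => i _; rewrite w0// addn_gt0 k0 orbT.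
  move=> i; have [] // : cbddmeas (fun t => c * P`_i * w t * circ t ^+ (i + k)).
  by apply: cbddmeasM; [exact: cbddmeasM (cbddmeas_cst _) _|exact: cbddmeasX cbddmeas_circ].
move=> t _; rewrite horner_coef -cRe_sum !mulr_sumr mulr_suml.
congr complex.Re; apply: eq_bigr => i _; rewrite exprD; ring.
Qed.

(* The negative part of a trigonometric polynomial close to [w] is orthogonal
   to [w] and to the nonnegative part, so that dropping it can only improve the
   approximation. *)
Lemma hardy_poly_dense w : hardy w -> forall e : R, 0 < e ->
  exists P : {poly C}, l2dist w (fun t => P.[circ t]) < e.
Proof.
move=> hw e e0; have [bw w0] := hw.
have [q [N [P qE]] wq] := trig_dense bw e0.
set T := take_poly N P; set D := drop_poly N P; exists D.
apply: le_lt_trans wq; have hD := hardy_poly D.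
have hwD := hardyB hw hD; have [bwD _] := hwD.
set d := fun t => w t - D.[circ t] in hwD bwD.
set m := fun t => circ t ^- N * T.[circ t].
have z0 t k : circ t ^+ k != 0 by rewrite expf_neq0// circ_neq0.
have qm t : q t = m t + D.[circ t].
  rewrite qE -{1}(poly_take_drop N P) hornerD hornerM hornerXn mulrDr.
  by rewrite [_ * circ t ^+ N]mulrC mulKf.
have bm : cbddmeas m by apply: cbddmeas_trigpoly; exists N, T.
have bcm : cbddmeas (fun t => (m t)^*%C).
  by case: bm => b1 b2; split; [apply: bddmeas_eq b1|apply: bddmeas_eq (bddmeasN b2)] => t _;
    case: (m t).
(* The conjugate of [m] is a combination of the powers [N - i] of [circ t] with [i < N]; these
   exponents are positive, so [hardy d] annihilates each term. *)
have ortho : mean (fun t => complex.Re (d t * (m t)^*%C)) = 0.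
  rewrite (@eq_mean _ _ (fun t => \sum_(i < size T)
      complex.Re ((T`_i)^*%C * d t * circ t ^+ (N - i)))).
    rewrite (mean_sum _ _).2.
      rewrite big1// => i _; rewrite hwD.2// subn_gt0.
      by rewrite (leq_trans (ltn_ord i))// size_take_poly.
    move=> i; have [] // : cbddmeas (fun t => (T`_i)^*%C * d t * circ t ^+ (N - i)).
    by apply: cbddmeasM; [exact: cbddmeasM (cbddmeas_cst _) _|exact: cbddmeasX cbddmeas_circ].
  move=> t _; rewrite -cRe_sum; congr complex.Re.
  have -> : (m t)^*%C = \sum_(i < size T) (T`_i)^*%C * circ t ^+ (N - i).
    rewrite /m horner_coef mulr_sumr [LHS]raddf_sum; apply: eq_bigr => i _.
    have iN : (i <= N)%N by rewrite ltnW// (leq_trans (ltn_ord i))// size_take_poly.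
    have -> : circ t ^- N * (T`_i * circ t ^+ i) = T`_i * circ t ^- (N - i).
      rewrite -{1}(subnK iN) exprD invfM mulrCA -mulrA.
      by rewrite mulVf ?mulr1.
    rewrite -[LHS]/((T`_i * circ t ^- (N - i))^*%C) [LHS]rmorphM; congr (_ * _).
    by rewrite -circ_natM circV; exact: conjcK.
  by rewrite mulr_sumr; apply: eq_bigr => i _; ring.
(* Pythagoras: [|d - m|^2 = |d|^2 + |m|^2 - 2 Re (d conj m)], the last term having mean 0. *)
have : l2dist w (fun t => D.[circ t]) + mean (fun t => sqnormc (m t)) = l2dist w q.
  have bdm : bddmeas (fun t => complex.Re (d t * (m t)^*%C)) by have [] := cbddmeasM bwD bcm.
  rewrite /l2dist -meanD; [|exact: bddmeas_sqnormc|exact: bddmeas_sqnormc].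
  rewrite -[LHS]addr0 -[X in _ + X = _](mulr0 (-2)) -[X in _ + _ * X = _]ortho.
  rewrite -meanZ// -meanD.
  - apply: eq_mean => t _; rewrite -/(d t).
    have -> : w t - q t = d t - m t by rewrite qm /d; ring.
    by case: (m t) (d t) => [a b] [a' b']; rewrite /sqnormc /=; ring.
  - by apply: bddmeasD; exact: bddmeas_sqnormc.
  - exact: bddmeasM (bddmeas_cst _) _.
have : 0 <= mean (fun t => sqnormc (m t)) by apply: mean_ge0 => t _; exact: sqnormc_ge0.
lra.
Qed.

Lemma cbddmeas_sqnormc_bound w : cbddmeas w -> exists2 K : R, 0 <= K & forall t, I01 t -> sqnormc (w t) <= K.
Proof.
move=> /bddmeas_sqnormc [_ [K wK]]; exists `|K| => // t It.
by rewrite (le_trans (ler_norm _))// (le_trans (wK _ It))// ler_norm.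
Qed.

(** Only [w] is approximated by polynomials [P]. As [f = c z^k v] is bounded, [f P] tends to [f w]
    in mean square, and each [f P] has mean 0 by [hardy_mul_poly]. *)
Lemma hardyM v w : hardy v -> hardy w -> hardy (fun t => v t * w t).
Proof.
move=> hv hw; have [bv v0] := hv; have [bw w0] := hw.
split=> [|k c k0]; first exact: cbddmeasM.
set f := fun t => c * circ t ^+ k * v t.
have bf : cbddmeas f.
  by apply: cbddmeasM => //; apply: cbddmeasM (cbddmeas_cst _) _; exact: cbddmeasX cbddmeas_circ.
rewrite (@eq_mean _ _ (fun t => complex.Re (f t * w t))); last first.
  by move=> t _; congr complex.Re; rewrite /f; ring.
apply: mean_eq0_limit; first exact: cbddmeasM.
move=> e e0; have [K K0 fK] := cbddmeas_sqnormc_bound bf.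
have K1 : 0 < K + 1 by rewrite ltr_wpDl.
have [|P wP] := hardy_poly_dense hw (e := e / (K + 1)); first by rewrite divr_gt0.
have bP : cbddmeas (fun t => P.[circ t]) by exact: cbddmeas_horner cbddmeas_circ.
exists (fun t => f t * P.[circ t]); split; first exact: cbddmeasM.
  rewrite -(hardy_mul_poly P c hv k0); apply: eq_mean => t _.
  by congr complex.Re; rewrite /f; ring.
apply: le_lt_trans (l2distM_le bf bw bP K0 fK) _.
move: wP; rewrite ltr_pdivlMr// => wP; apply: le_lt_trans wP.
by rewrite mulrC ler_wpM2l ?lerDl// mean_ge0// => t _; exact: sqnormc_ge0.
Qed.

End L2Density.

(** * The map [z |-> z^n] and its invariance properties *)

Section CircleCover.
Context {R : realType}.
Local Notation C := R[i].
Local Notation I01 := (@I01 R).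
Local Notation circ := (@circ R).
Local Notation mu := (@lebesgue_measure R).
Variables (n : nat) (n0 : (0 < n)%N).

(** The fractional part of [n t], that is, [z |-> z^n] read on the parameter interval. *)
Definition winding (t : R) : R := n%:R * t - (Num.truncn (n%:R * t))%:R.

Lemma winding_I01 t : I01 t -> I01 (winding t).
Proof.
rewrite /Defs.I01/= !in_itv/= => /andP[t0 _].
have /truncn_itv/andP[a b] : 0 <= n%:R * t by rewrite mulr_ge0.
by rewrite /winding subr_ge0 a ltrBlDl natr1.
Qed.

Lemma circ_winding t : circ (winding t) = circ t ^+ n.
Proof.
rewrite -circ_natM /winding; set k := Num.truncn _.
by rewrite -[in RHS](subrK k%:R (n%:R * t)) [RHS]circD circ_nat mulr1.
Qed.

(** Monotone class argument, in which the class also records that the composite is bounded and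
    measurable. For trigonometric polynomials both means are the same coefficient of [P], by
    [mean_trigpoly] at [n] and at 1. *)
Lemma mean_winding (u : R -> R) : bddmeas u ->
  bddmeas (u \o winding) /\ mean (u \o winding) = mean u.
Proof.
move=> bu; pose S (u : R -> R) :=
  bddmeas u /\ bddmeas (u \o winding) /\ mean (u \o winding) = mean u.
suff [] : S u by [].
apply: (@trig_monotone_class R S) => //
  [q tq|a u1 u2 [b1 [c1 e1]] [b2 [c2 e2]]|v_ w M Sv vM vw].
- have [N [P qE]] := tq.
  have [bq _] := cbddmeas_trigpoly tq.
  have qwE t : ((q (winding t))%:C)%C = circ t ^- (n * N) * P.[circ t ^+ n].
    by rewrite qE circ_winding -exprM.
  split=> //; split.
    have [] // : cbddmeas (fun t => ((q (winding t))%:C)%C).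
    rewrite (_ : (fun t => _) = fun t => (circ t)^-1 ^+ (n * N) * P.[circ t ^+ n]).
      apply: cbddmeasM; first exact: cbddmeasX cbddmeas_circV.
      by apply: cbddmeas_horner; exact: cbddmeasX cbddmeas_circ.
    by apply/funext => t; rewrite qwE exprVn.
  have h1 := mean_trigpoly P N n0.
  have h2 := mean_trigpoly P N (ltn0Sn 0).
  transitivity (complex.Re P`_N); [rewrite -h1|rewrite -h2]; apply: eq_mean => t _.
    by rewrite -qwE.
  by rewrite mul1n expr1 -qE.
- have bz := bddmeas_cst a.
  split; first by apply: bddmeasD => //; exact: bddmeasM.
  split; first by apply: bddmeasD => //; exact: (bddmeasM bz c1).
  have := meanD (bddmeasM bz c1) c2; have := meanD (bddmeasM bz b1) b2.
  by rewrite !meanZ// e1 e2 => <-.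
- have [bw h1] := bounded_limit (fun k => (Sv k).1.1) vM vw.
  have [||| bw' h2] := @bounded_limit _ (fun k => v_ k \o winding) (w \o winding) M.
  + by move=> k; exact: (Sv k).2.1.1.
  + by move=> k t It; apply: vM; exact: winding_I01.
  + by move=> t It; apply: vw; exact: winding_I01.
  split=> //; split=> //.
  have E : (fun k => mean (v_ k \o winding)) = (fun k => mean (v_ k)).
    by apply/funext => k; exact: (Sv k).2.2.
  rewrite E in h2.
  exact: (cvg_unique (@norm_hausdorff _ _) h2 h1).
Qed.

(** Obtained by composing with the identity, which is bounded on [I01]. *)
Lemma measurable_winding : measurable_fun I01 winding.
Proof.
have [|[] //] := @mean_winding id.
split; first exact: measurable_id.
by exists 1 => t; rewrite /Defs.I01/= in_itv/= => /andP[t0 t1]; rewrite ger0_norm// ltW.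
Qed.

(** The measure of the preimage of a null set is the mean of its indicator composed with [winding],
    hence the mean of the indicator itself. *)
Lemma negligible_winding (A : set R) : mu.-negligible (I01 `&` A) ->
  mu.-negligible (I01 `&` winding @^-1` A).
Proof.
move=> [N [mN N0 AN]]; have mN' : measurable (N : set R) by exact: mN.
exists (I01 `&` winding @^-1` N); split.
- by apply: measurable_winding; [exact: measurable_I01|exact: mN'].
- have bN : bddmeas (\1_N : R -> R).
    split; first exact: measurable_indic.
    by exists 1 => t _; rewrite indicE; case: (_ \in _); rewrite ?normr1 ?normr0.
  have [b1 e1] := mean_winding bN.
  have mW : measurable (I01 `&` winding @^-1` N) by apply: measurable_winding; [exact: measurable_I01|exact: mN'].
  have hN : mean (\1_N : R -> R) = 0.
    apply: EFin_inj; rewrite EFin_mean// integral_indic//;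
      last exact: measurable_I01.
    apply: (subset_measure0 _ mN (@subIsetl _ N I01) N0).
    exact: (measurableI _ _ mN' measurable_I01).
  have : (mean (\1_N \o winding))%:E = mu (I01 `&` winding @^-1` N).
    rewrite EFin_mean//.
    rewrite (_ : I01 `&` _ = (I01 `&` winding @^-1` N) `&` I01); last first.
      by apply/seteqP; split=> t /=; tauto.
    rewrite -integral_indic//; last exact: measurable_I01.
    apply: eq_integral => t /set_mem It.
    congr (_%:E); rewrite /= !indicE; congr ((nat_of_bool _)%:R).
    by apply/idP/idP; rewrite !inE /=; [split|case].
  by rewrite e1 hN.
- by move=> t [It At]; split=> //; apply: AN; split=> //; exact: winding_I01.
Qed.

(** If polynomials [P] approximate [w], then [P (z^n)], again a polynomial in [z], approximates the
    composite equally well, since [winding] preserves [l2dist]. *)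
Lemma hardy_winding (w : R -> C) : hardy w -> hardy (w \o winding).
Proof.
move=> hw; have [[bw1 bw2] w0] := hw.
have bw : cbddmeas w by split.
have bwt v : cbddmeas v -> cbddmeas (v \o winding).
  by move=> [b1 b2]; split; [exact: (mean_winding b1).1|exact: (mean_winding b2).1].
split=> [|k c k0]; first exact: bwt.
set f := fun t : R => c * circ t ^+ k.
have bf : cbddmeas f by apply: cbddmeasM (cbddmeas_cst _) _; exact: cbddmeasX cbddmeas_circ.
rewrite (@eq_mean _ _ (fun t => complex.Re (f t * (w \o winding) t))); last first.
  by move=> t _; congr complex.Re; rewrite /f mulrAC.
apply: mean_eq0_limit; first by apply: cbddmeasM => //; exact: bwt.
move=> e e0; have [K K0 fK] := cbddmeas_sqnormc_bound bf.
have K1 : 0 < K + 1 by rewrite ltr_wpDl.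
have [|P wP] := hardy_poly_dense hw (e := e / (K + 1)); first by rewrite divr_gt0.
have bP : cbddmeas (fun t => P.[circ t]) by exact: cbddmeas_horner cbddmeas_circ.
exists (fun t => f t * ((fun t => P.[circ t]) \o winding) t); split.
- by apply: cbddmeasM => //; exact: bwt.
- rewrite -((hardy_poly (P \Po 'X^n)).2 k c k0); apply: eq_mean => t _.
  congr complex.Re; rewrite /f /= circ_winding horner_comp hornerXn; ring.
apply: le_lt_trans (l2distM_le bf (bwt _ bw) (bwt _ bP) K0 fK) _.
have -> : l2dist (w \o winding) ((fun t => P.[circ t]) \o winding) =
    l2dist w (fun t => P.[circ t]).
  exact: (mean_winding (bddmeas_sqnormc (cbddmeasB bw bP))).2.
move: wP; rewrite ltr_pdivlMr// => wP; apply: le_lt_trans wP.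
by rewrite mulrC ler_wpM2l ?lerDl// mean_ge0// => t _; exact: sqnormc_ge0.
Qed.

End CircleCover.

(** * The algebras [L^infty] and [H^infty] on the circle *)

Section BoundedCircleFunctions.
Context {R : realType}.
Local Notation C := R[i].
Local Notation I01 := (@I01 R).
Local Notation circ := (@circ R).
Local Notation mu := (@lebesgue_measure R).
Implicit Types f g h : cfun R.

Lemma measurable_fun_le_indic (u v : R -> R) : measurable_fun I01 u ->
  measurable_fun I01 v -> measurable_fun I01 (fun t => (u t <= v t)%R%:R : R).
Proof.
move=> mu_ mv; pose E := I01 `&` (v \- u) @^-1` `[0, +oo[.
have mE : measurable E.
  by apply: measurable_funB => //; exact: measurable_itv.
apply: (@eq_measurable_fun _ _ _ _ _ (\1_E : R -> R)); last exact: measurable_indic.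
move=> t /set_mem It; rewrite indicE; congr ((nat_of_bool _)%:R).
by apply/idP/idP; rewrite inE /E /= in_itv/= andbT subr_ge0; [case|].
Qed.

Lemma Tmeasurable_funD f g : Tmeasurable_fun f -> Tmeasurable_fun g ->
  Tmeasurable_fun (fun z => f z + g z).
Proof. exact: cmeasD. Qed.

Lemma Tmeasurable_funB f g : Tmeasurable_fun f -> Tmeasurable_fun g ->
  Tmeasurable_fun (fun z => f z - g z).
Proof. exact: cmeasB. Qed.

Lemma Tmeasurable_funM f g : Tmeasurable_fun f -> Tmeasurable_fun g ->
  Tmeasurable_fun (fun z => f z * g z).
Proof. exact: cmeasM. Qed.

Lemma Linf_bounded f (M : R) : Tmeasurable_fun f ->
  (forall t, normc (f (circ t)) <= M) -> Linf f.
Proof.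
move=> mf fM; split=> //; exists M.
apply: negligibleS (negligible_set0 _) => t [_ /=]; apply.
by rewrite normcC lecR.
Qed.

Lemma Linf_cst (c : C) : Linf (fun=> c).
Proof. by apply: (@Linf_bounded _ (normc c)) => //; exact: cmeas_cst. Qed.

Lemma aeeq_refl f : aeeq f f.
Proof. by apply: negligibleS (negligible_set0 _) => t [_ /=]. Qed.

Lemma aeeqM f f' g g' : aeeq f f' -> aeeq g g' ->
  aeeq (fun z => f z * g z) (fun z => f' z * g' z).
Proof.
move=> ff gg; apply: negligibleS (negligibleU ff gg) => t [It /= fg].
have [fE|fN] := pselect (f (circ t) = f' (circ t)); last by left.
by right; split=> //= gE; apply: fg; rewrite fE gE.
Qed.

(** Replaces [f] by 0 where its modulus exceeds [M]. For [M] above the essential bound this gives an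
    everywhere bounded representative of the same class. *)
Definition cutoff (M : R) f : cfun R :=
  fun z => (((normc (f z) <= M)%R%:R : R)%:C)%C * f z.

Lemma Tmeasurable_cutoff M f : Tmeasurable_fun f -> Tmeasurable_fun (cutoff M f).
Proof.
move=> mf; apply: Tmeasurable_funM => //; apply: cmeas_real.
by apply: measurable_fun_le_indic; [exact: cmeas_normc|exact: measurable_cst].
Qed.

Lemma cutoff_bound M f z : 0 <= M -> normc (cutoff M f z) <= M.
Proof.
rewrite /cutoff normcM normc_real => M0.
by case: (leP (normc (f z)) M) => h; rewrite /= ?normr1 ?normr0 ?mul1r ?mul0r.
Qed.

Lemma cutoff_le M f z : normc (cutoff M f z) <= normc (f z).
Proof.
rewrite /cutoff normcM normc_real.
by case: (leP (normc (f z)) M) => h; rewrite /= ?normr1 ?normr0 ?mul1r ?mul0r ?normc_ge0.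
Qed.

Lemma Linf_cutoff f : Linf f -> exists M : R, [/\ 0 < M,
  Linf (cutoff M f) & aeeq f (cutoff M f)].
Proof.
(* An essential bound may be zero or, formally, negative; [|M| + 1] is positive and still a
   bound. *)
move=> [mf [M fM]]; exists (`|M| + 1).
have M0 : 0 < `|M| + 1 by rewrite ltr_wpDl.
split=> //.
  apply: (@Linf_bounded _ (`|M| + 1)); first exact: Tmeasurable_cutoff.
  by move=> t; apply: cutoff_bound; exact: ltW.
apply: negligibleS fM => t [It /= fN]; split=> //=.
rewrite normcC lecR => h; apply: fN; rewrite /cutoff.
by rewrite (le_trans h) ?mul1r// (le_trans (ler_norm _))// lerDl.
Qed.

Lemma LinfM f g : Linf f -> Linf g -> Linf (fun z => f z * g z).
Proof.
move=> [mf [M fM]] [mg [N gN]]; split; first exact: Tmeasurable_funM.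
exists (`|M| * `|N|); apply: negligibleS (negligibleU fM gN) => t [It /=].
rewrite !normcC !lecR normcM => h.
have [fM'|/negP fM'] := boolP (normc (f (circ t)) <= M); last first.
  by left.
right; split=> // gN'; apply: h.
rewrite ler_pM ?normc_ge0//.
  exact: le_trans fM' (ler_norm _).
exact: le_trans gN' (ler_norm _).
Qed.

Lemma LinfD f g : Linf f -> Linf g -> Linf (fun z => f z + g z).
Proof.
move=> [mf [M fM]] [mg [N gN]]; split; first exact: Tmeasurable_funD.
exists (M + N); apply: negligibleS (negligibleU fM gN) => t [It /=].
rewrite !normcC !lecR => h.
have [fM'|/negP fM'] := boolP (normc (f (circ t)) <= M); last first.
  by left.
right; split=> // gN'; apply: h.
by apply: le_trans (le_normcD _ _) _; exact: lerD.
Qed.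

Lemma LinfB f g : Linf f -> Linf g -> Linf (fun z => f z - g z).
Proof.
move=> Lf Lg; have := LinfD Lf (LinfM (Linf_cst (-1)) Lg).
by under eq_fun do rewrite mulN1r.
Qed.

Lemma Linf_horner (p : {poly C}) (c : C) : Linf (fun z => p.[c * z]).
Proof.
have Lz : Linf (fun z : C => c * z).
  apply: LinfM; first exact: Linf_cst.
  by apply: (@Linf_bounded _ 1); [exact: cmeas_circ|move=> t; rewrite normc_circ].
elim/poly_ind: p => [|p d IH].
  by under eq_fun do rewrite horner0; exact: Linf_cst.
under eq_fun do rewrite hornerMXaddC.
by apply: LinfD; [exact: LinfM|exact: Linf_cst].
Qed.

(** [phi] stands for the real or the imaginary part, the two cases in the definition of [Hinf]. *)
Lemma integral_aeeq (phi : C -> R) f g (k : nat) :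
  (forall f, Tmeasurable_fun f ->
     measurable_fun I01 (fun t => phi (f (circ t) * circ t ^+ k))) ->
  Tmeasurable_fun f -> Tmeasurable_fun g -> aeeq f g ->
  (\int[mu]_(t in I01) (phi (f (circ t) * circ t ^+ k))%:E =
   \int[mu]_(t in I01) (phi (g (circ t) * circ t ^+ k))%:E)%E.
Proof.
move=> mphi mf mg fg; apply: ae_eq_integral.
- exact: measurable_I01.
- by apply/measurable_EFinP; exact: mphi.
- by apply/measurable_EFinP; exact: mphi.
- apply: negligibleS fg => t /= h.
  have [It|nIt] := pselect (I01 t); last by exfalso; apply: h => /nIt.
  by split=> //= fgt; apply: h => _; rewrite fgt.
Qed.

Let mRe k f : Tmeasurable_fun f ->
  measurable_fun I01 (fun t => complex.Re (f (circ t) * circ t ^+ k)).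
Proof. by move=> mf; have [] := cmeasM mf (cmeasX k cmeas_circ). Qed.

Let mIm k f : Tmeasurable_fun f ->
  measurable_fun I01 (fun t => complex.Im (f (circ t) * circ t ^+ k)).
Proof. by move=> mf; have [] := cmeasM mf (cmeasX k cmeas_circ). Qed.

(** With its converse [hardy_Hinf], this passes between classes modulo null sets and everywhere
    bounded representatives, for which the [L^2] arguments were made. *)
Lemma Hinf_hardy f g : Hinf f -> aeeq f g -> cbddmeas (g \o circ) -> hardy (g \o circ).
Proof.
move=> [[mf _] f0] fg bg; split=> // k c k0.
have mg : Tmeasurable_fun g by case: bg => -[? _] [? _].
have [re0 im0] := f0 k k0.
rewrite (integral_aeeq (mRe k) mf mg fg) in re0.
rewrite (integral_aeeq (mIm k) mf mg fg) in im0.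
have [bre bim] := cbddmeasM bg (cbddmeasX k cbddmeas_circ).
rewrite (@eq_mean _ _ (fun t => complex.Re c * complex.Re (g (circ t) * circ t ^+ k)
  + - complex.Im c * complex.Im (g (circ t) * circ t ^+ k))); last first.
  by move=> t _; rewrite -mulrA cReM mulNr.
rewrite meanD; [|exact: bddmeasM (bddmeas_cst _) _|exact: bddmeasM (bddmeas_cst _) _].
rewrite !meanZ// /mean /Rintegral.
by rewrite [X in fine X]re0 [X in _ + _ * fine X]im0 /= !mulr0 addr0.
Qed.

Lemma hardy_Hinf f g : Linf f -> aeeq f g -> hardy (g \o circ) -> Hinf f.
Proof.
move=> Lf fg [bg g0]; have [mf _] := Lf; split=> // k k0.
have mg : Tmeasurable_fun g by case: bg => -[? _] [? _].
have [bre bim] := cbddmeasM bg (cbddmeasX k cbddmeas_circ).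
rewrite (integral_aeeq (mRe k) mf mg fg) (integral_aeeq (mIm k) mf mg fg).
split.
  rewrite -(EFin_mean bre); apply: (@congr1 _ _ EFin _ 0).
  rewrite -(g0 k 1 k0); apply: eq_mean => t _.
  by rewrite mul1r.
rewrite -(EFin_mean bim); apply: (@congr1 _ _ EFin _ 0).
(* The coefficient [-i] turns a real part into an imaginary part. *)
rewrite -(g0 k (Complex 0 (-1)) k0); apply: eq_mean => t _; rewrite -mulrA cReM /=.
by rewrite mul0r mulN1r opprK add0r.
Qed.

Lemma cbddmeas_cutoff M f : 0 <= M -> Tmeasurable_fun f -> cbddmeas (cutoff M f \o circ).
Proof.
move=> M0 mf; apply: (@cbddmeasP _ _ M); first exact: Tmeasurable_cutoff.
by move=> t _; exact: cutoff_bound.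
Qed.

Lemma HinfM f g : Hinf f -> Hinf g -> Hinf (fun z => f z * g z).
Proof.
move=> Hf Hg; have [Lf _] := Hf; have [Lg _] := Hg.
have [M [M0 _ fM]] := Linf_cutoff Lf; have [N [N0 _ gN]] := Linf_cutoff Lg.
apply: (hardy_Hinf _ (aeeqM fM gN)); first exact: LinfM.
apply: hardyM.
  exact: Hinf_hardy Hf fM (cbddmeas_cutoff (ltW M0) Lf.1).
exact: Hinf_hardy Hg gN (cbddmeas_cutoff (ltW N0) Lg.1).
Qed.

(** On the circle [g (z^n)] is [g] composed with [winding]: exceptional sets are pulled back by
    [negligible_winding], Fourier conditions by [hardy_winding]. *)
Lemma Hinf_zn_sub n f : (0 < n)%N -> Hinf_zn n f -> Hinf f.
Proof.
move=> n0 [g Hg ->]; have [Lg _] := Hg.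
have [M [M0 _ gM]] := Linf_cutoff Lg.
have hg := Hinf_hardy Hg gM (cbddmeas_cutoff (ltW M0) Lg.1).
have wE h : (fun t => h (circ t ^+ n)) = (h \o circ) \o winding n.
  by apply/funext => t /=; rewrite circ_winding.
apply: (@hardy_Hinf _ (fun z => cutoff M g (z ^+ n))).
- have [[rg ig] [N gN]] := Lg; split.
    have mw (u : R -> R) : measurable_fun I01 u -> measurable_fun I01 (u \o winding n).
      move=> mu_; apply: (measurable_comp measurable_I01 _ mu_).
        by move=> _ [t It <-]; exact: winding_I01.
      exact: measurable_winding.
    split.
      by have := mw _ rg; apply: eq_measurable_fun => t _ /=; rewrite circ_winding.
    by have := mw _ ig; apply: eq_measurable_fun => t _ /=; rewrite circ_winding.
  exists N; have := negligible_winding n0 gN; apply: negligibleS => t [It /= h].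
  by split=> //=; rewrite circ_winding.
- have := negligible_winding n0 gM; apply: negligibleS => t [It /= h].
  by split=> //=; rewrite circ_winding.
- have := hardy_winding n0 hg; rewrite -(wE (cutoff M g)).
  exact.
Qed.

Lemma Hinf_cst c : Hinf (fun=> c : C).
Proof.
apply: (hardy_Hinf (Linf_cst c) (aeeq_refl _)).
have := hardy_poly (c%:P); congr hardy.
by apply/funext => t /=; rewrite hornerC.
Qed.

End BoundedCircleFunctions.

(** * Monotonicity, triangle inequality and bounded multipliers for the extended norm *)

Section RotationallySymmetricNorm.
Context {R : realType}.
Local Notation C := R[i].
Local Notation I01 := (@I01 R).
Local Notation circ := (@circ R).
Implicit Types f g h s : cfun R.

Lemma eq_on_circle_aeeq f g : (forall t, f (circ t) = g (circ t)) -> aeeq f g.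
Proof. by move=> fg; apply: negligibleS (negligible_set0 _) => t [_ /=]; rewrite fg. Qed.

Lemma Tsimple_Linf s : Tsimple s -> Linf s.
Proof.
move=> [ms /finite_seqP[r rE]].
have [M rM] : exists M : R, forall z, z \in r -> normc z <= M.
  elim: r {rE} => [|x r [M IH]]; first by exists 0.
  exists (Num.max (normc x) M) => z; rewrite inE le_max => /predU1P[->|/IH ->].
    by rewrite lexx.
  by rewrite orbT.
apply: (@Linf_bounded _ _ M) => // t; apply: rM.
have : range (fun t => s (circ t)) (s (circ t)) by exists t.
by rewrite rE.
Qed.

Lemma Tsimple_cst (c : C) : Tsimple (fun=> c).
Proof.
split; first exact: cmeas_cst.
by apply: (@sub_finite_set _ _ [set c]); [move=> _ [t _ <-]|exact: finite_set1].
Qed.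

Lemma Tsimple_op (op : C -> C -> C) f g :
  Tmeasurable_fun (fun z => op (f z) (g z)) -> Tsimple f -> Tsimple g ->
  Tsimple (fun z => op (f z) (g z)).
Proof.
move=> mfg [_ ff] [_ fg]; split=> //.
apply: sub_finite_set (finite_image2 op ff fg) => _ [t _ <-].
by exists (f (circ t)); [exists t|exists (g (circ t)); [exists t|]].
Qed.

Lemma TsimpleM f g : Tsimple f -> Tsimple g -> Tsimple (fun z => f z * g z).
Proof.
by move=> sf sg; apply: (Tsimple_op _ sf sg); exact: Tmeasurable_funM sf.1 sg.1.
Qed.

Lemma TsimpleD f g : Tsimple f -> Tsimple g -> Tsimple (fun z => f z + g z).
Proof.
by move=> sf sg; apply: (Tsimple_op _ sf sg); exact: Tmeasurable_funD sf.1 sg.1.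
Qed.

Lemma Tsimple_le_indic (u v : C -> R) :
  measurable_fun I01 (fun t => u (circ t)) ->
  measurable_fun I01 (fun t => v (circ t)) ->
  Tsimple (fun z => (((u z <= v z)%R%:R : R)%:C)%C).
Proof.
move=> mu_ mv; split.
  by apply: cmeas_real; exact: (measurable_fun_le_indic mu_ mv).
apply: (@sub_finite_set _ _ ([set 0] `|` [set 1])).
  by move=> _ [t _ <-]; case: (u _ <= v _)%R; [right|left]; rewrite ?rmorph1 ?rmorph0.
by rewrite finite_setU; split; exact: finite_set1.
Qed.

(** The binary expansion again, now producing a simple minorant of [u]. The bounds hold for every
    real [t], as the supremum in [alpha_ext] asks. *)
Lemma simple_halving k (u : C -> R) (m : R) :
  measurable_fun I01 (fun t => u (circ t)) ->
  (forall t, 0 <= u (circ t) <= m) ->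
  exists s : C -> R, [/\ Tsimple (fun z => ((s z)%:C)%C),
    forall t, 0 <= s (circ t) & forall t, 0 <= u (circ t) - s (circ t) <= m / 2 ^+ k].
Proof.
elim: k u m => [|k IH] u m mu_ um.
  exists (fun=> 0); split=> //; first exact: Tsimple_cst.
  by move=> t; rewrite subr0 expr0 divr1.
pose b z : R := (m / 2 <= u z)%R%:R.
have sb : Tsimple (fun z => ((b z)%:C)%C).
  by apply: (@Tsimple_le_indic (fun=> m / 2)) => //; exact: measurable_cst.
have [||s [ss s0 us]] := IH (fun z => u z - m / 2 * b z) (m / 2).
- apply: measurable_funB => //; apply: measurable_funM; first exact: measurable_cst.
  by have [[]] := sb.
- move=> t; have /andP[u0 u1] := um t; rewrite /b.
  by case: (leP (m / 2) (u (circ t))) => h /=; apply/andP; split; lra.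
have m0 : 0 <= m by have /andP[u0] := um 0; exact: le_trans.
exists (fun z => m / 2 * b z + s z); split.
- have := TsimpleD (TsimpleM (Tsimple_cst ((m / 2)%:C)%C) sb) ss.
  by under eq_fun do rewrite -rmorphM -rmorphD.
- by move=> t; rewrite addr_ge0// mulr_ge0// ?divr_ge0.
- by move=> t; rewrite opprD addrA exprS invfM mulrA us.
Qed.

Variables (alpha : cfun R -> R) (Hn : rot_sym_norm alpha).

Let a_scale f (r : R) : Linf f -> 0 <= r ->
  alpha (fun z => (r%:C)%C * f z) = r * alpha f.
Proof.
have [[_ _ + _ _] _ _ _] := Hn => h Lf r0; have := h f (r%:C)%C Lf.
by rewrite normcC normc_real ger0_norm// -rmorphM => /complexI.
Qed.

Lemma alpha_opp f : Linf f -> alpha (fun z => - f z) = alpha f.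
Proof.
have [[_ _ + _ _] _ _ _] := Hn => h Lf; have := h f (-1) Lf.
rewrite normrN1 mul1r => /complexI; under [in alpha _]eq_fun do rewrite mulN1r.
by [].
Qed.

Lemma alpha_triangle f g : Linf f -> Linf g -> alpha (fun z => f z + g z) <= alpha f + alpha g.
Proof. by have [[_ _ _ + _] _ _ _] := Hn; apply. Qed.

Let a_ae f g : Linf f -> Linf g -> aeeq f g -> alpha f = alpha g.
Proof. by have [[_ _ _ _ +] _ _ _] := Hn; apply. Qed.

Let a_one : alpha (fun=> 1) = 1. Proof. by have [] := Hn. Qed.

Let a_abs f : Linf f -> alpha (fun z => `|f z|) = alpha f.
Proof. by have [_ _ + _] := Hn; apply. Qed.

Lemma alpha_rot f (w : C) : Linf f -> `|w| = 1 -> alpha (fun z => f (w * z)) = alpha f.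
Proof.
have [_ _ _ h] := Hn => Lf w1.
by rewrite -(h f (Num.conj w) Lf) ?norm_conjC//; congr alpha;
  apply/funext => z; rewrite conjCK.
Qed.

(* [u] is the average of the unimodular functions [u +- i sqrt (1 - u^2)]. *)
Lemma alpha_le1 (u : C -> R) : measurable_fun I01 (fun t => u (circ t)) ->
  (forall t, 0 <= u (circ t) <= 1) -> alpha (fun z => ((u z)%:C)%C) <= 1.
Proof.
move=> mu_ u01; pose v z := Num.sqrt (1 - u z ^+ 2).
pose U (e : R) : cfun R := fun z => Complex (u z) (e * v z).
have ms : measurable_fun [set: R] (@Num.sqrt R).
  by apply: continuous_measurable_fun; exact: sqrt_continuous.
have mv : measurable_fun I01 (fun t => v (circ t)).
  apply: (measurableT_comp ms); apply: measurable_funB; first exact: measurable_cst.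
  exact: measurable_funX.
have mU e : Tmeasurable_fun (U e).
  by split=> //; apply: measurable_funM => //; exact: measurable_cst.
have nU e t : e ^+ 2 = 1 -> normc (U e (circ t)) = 1.
  move=> e1; have /andP[u0 u1] := u01 t.
  rewrite /U /normc exprMn e1 mul1r /v sqr_sqrtr; first by rewrite addrC subrK sqrtr1.
  by rewrite subr_ge0 exprn_ile1.
have LU e : e ^+ 2 = 1 -> Linf (U e).
  by move=> e1; apply: (@Linf_bounded _ _ 1) => // t; rewrite nU.
have aU e : e ^+ 2 = 1 -> alpha (U e) = 1.
  move=> e1; rewrite -a_abs; last exact: LU.
  rewrite -a_one; apply: a_ae; last by apply: eq_on_circle_aeeq => t; rewrite normcC nU.
    apply: (@Linf_bounded _ _ 1).
      by apply: cmeas_real; exact: cmeas_normc (mU e).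
    by move=> t; rewrite normcC normc_real nU// normr1.
  exact: Linf_cst.
have p1 : (1 : R) ^+ 2 = 1 by rewrite expr1n.
have m1 : (-1 : R) ^+ 2 = 1 by rewrite sqrrN expr1n.
have -> : (fun z => ((u z)%:C)%C) = fun z => ((2^-1 : R)%:C)%C * (U 1 z + U (-1) z).
  apply/funext => z; apply/eqP; rewrite eq_complex /U /=.
  by apply/andP; split; apply/eqP; field.
rewrite a_scale ?invr_ge0//; last by apply: LinfD; exact: LU.
have := alpha_triangle (LU _ p1) (LU _ m1); rewrite !aU//; lra.
Qed.

Lemma alpha_le_ub (u : C -> R) (m : R) : measurable_fun I01 (fun t => u (circ t)) ->
  0 < m -> (forall t, 0 <= u (circ t) <= m) -> alpha (fun z => ((u z)%:C)%C) <= m.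
Proof.
move=> mu_ m0 um.
have mv : measurable_fun I01 (fun t => m^-1 * u (circ t)).
  by apply: measurable_funM => //; exact: measurable_cst.
have v01 t : 0 <= m^-1 * u (circ t) <= 1.
  have /andP[u0 u1] := um t.
  by rewrite mulr_ge0 ?invr_ge0 ?(ltW m0)//= mulrC ler_pdivrMr// mul1r.
have -> : (fun z => ((u z)%:C)%C) = fun z => (m%:C)%C * ((m^-1 * u z)%:C)%C.
  by apply/funext => z; rewrite -rmorphM mulrA divff ?mul1r// gt_eqF.
rewrite a_scale ?(ltW m0)//.
  by rewrite -[leRHS]mulr1 ler_pM2l//; exact: (alpha_le1 (u := fun z => m^-1 * u z)).
apply: (@Linf_bounded _ _ 1); first exact: cmeas_real.
by move=> t; rewrite normc_real; have /andP[v0 v1] := v01 t; rewrite ger0_norm.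
Qed.

(** The way back from [alpha_ext] to [alpha]: a simple minorant of [|f|] is admissible for [g], and
    the remainder, at most [M / 2^k] everywhere, has small norm by [alpha_le_ub]. *)
Lemma alpha_le_ext f g : Linf f ->
  (forall t, normc (f (circ t)) <= normc (g (circ t))) ->
  ((alpha f)%:E <= alpha_ext alpha g)%E.
Proof.
move=> Lf fg; have [M [M0 Lf' ff']] := Linf_cutoff Lf.
set f' := cutoff M f in Lf' ff'.
have mn : measurable_fun I01 (fun t => normc (f' (circ t))) by exact: cmeas_normc Lf'.1.
rewrite (a_ae Lf Lf' ff') -a_abs//.
apply/lee_addgt0Pr => e e0.
have [k kM] : exists k : nat, M / 2 ^+ k < e.
  have [k] := near_infty_natSinv_expn_lt (PosNum (divr_gt0 e0 M0)).
  move=> _ /(_ k (leqnn k)) /=; rewrite ltr_pdivlMr// => h; exists k.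
  by rewrite mulrC; move: h; rewrite div1r.
have [|s [ss s0 fs]] := simple_halving k (u := fun z => normc (f' z)) (m := M) mn.
  by move=> t; rewrite normc_ge0 cutoff_bound// ltW.
set d := fun z : C => ((normc (f' z) - s z)%:C)%C.
have md : measurable_fun I01 (fun t => normc (f' (circ t)) - s (circ t)).
  by apply: measurable_funB => //; case: ss => -[].
have Ld : Linf d.
  apply: (@Linf_bounded _ _ (M / 2 ^+ k)); first exact: cmeas_real.
  by move=> t; rewrite normc_real; have /andP[? ?] := fs t; rewrite ger0_norm.
have Ls := Tsimple_Linf ss.
have -> : (fun z => `|f' z|) = fun z => ((s z)%:C)%C + d z.
  by apply/funext => z; rewrite normcC /d -rmorphD addrC subrK.
apply: (@le_trans _ _ ((alpha (fun z => ((s z)%:C)%C))%:E + e%:E)%E).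
  rewrite -EFinD lee_fin (le_trans (alpha_triangle Ls Ld))// lerD2l (le_trans _ (ltW kM))//.
  apply: (alpha_le_ub (u := fun z => normc (f' z) - s z)) => //.
  by rewrite divr_gt0// exprn_gt0.
rewrite leeD2r//; apply: ereal_sup_ubound; exists (fun z => ((s z)%:C)%C) => //.
split=> // t; rewrite normcC ler0c lecR s0/=.
have /andP[h _] := fs t; rewrite subr_ge0 in h.
by rewrite (le_trans h)// (le_trans (cutoff_le _ _ _)).
Qed.

(** In the order of [R[i]], [0 <= z] forces the imaginary part to vanish, so admissible simple
    functions are real on the circle. *)
Let simple_Re s f : Tsimple s -> (forall t, 0 <= s (circ t) <= `|f (circ t)|) ->
  [/\ forall t, s (circ t) = ((complex.Re (s (circ t)))%:C)%C,
      forall t, 0 <= complex.Re (s (circ t)) &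
      forall t, complex.Re (s (circ t)) <= normc (f (circ t))].
Proof.
move=> ss sf; split=> t; have := sf t; rewrite normcC; case: (s (circ t)) => a b;
  rewrite !lecE /= => /andP[/andP[/eqP b0 a0] /andP[_ af]] //.
by rewrite b0.
Qed.

(** A simple [s] below [|f + g|] splits as [min (s, |f|)] plus a remainder below [|g|]. The pieces
    need not be simple, but they are bounded, and [alpha_le_ext] covers them. *)
Lemma alpha_ext_triangle f g : Tmeasurable_fun f -> Tmeasurable_fun g ->
  (alpha_ext alpha (fun z => (f z + g z)%R) <= alpha_ext alpha f + alpha_ext alpha g)%E.
Proof.
move=> mf mg; apply: ge_ereal_sup => _ [s [ss sfg] <-].
have [sE s0 sle] := simple_Re (f := fun z => f z + g z) ss sfg.
have [ms [M sM]] := Tsimple_Linf ss.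
pose r z := complex.Re (s z).
have mr : measurable_fun I01 (fun t => r (circ t)) by exact: ms.1.
have Lr : Linf (fun z => ((r z)%:C)%C).
  split; first exact: cmeas_real.
  by exists M; apply: negligibleS sM => t [It /=]; rewrite /r -sE.
pose a z := Num.min (r z) (normc (f z)).
have ma : measurable_fun I01 (fun t => a (circ t)).
  by apply: measurable_minr => //; exact: cmeas_normc.
have a0 t : 0 <= a (circ t) by rewrite le_min s0 normc_ge0.
have ar t : a (circ t) <= r (circ t) by rewrite ge_min lexx.
have Lar (b : C -> R) : measurable_fun I01 (fun t => b (circ t)) ->
    (forall t, 0 <= b (circ t) <= r (circ t)) -> Linf (fun z => ((b z)%:C)%C).
  move=> mb br; split; first exact: cmeas_real.
  case: Lr => _ [N rN]; exists N; apply: negligibleS rN => t [It /= h].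
  split=> //= h'; apply: h; apply: le_trans h'.
  rewrite !normcC !normc_real lecR; have /andP[b0 br'] := br t.
  by rewrite !ger0_norm// (le_trans b0).
have La : Linf (fun z => ((a z)%:C)%C) by apply: Lar => // t; rewrite a0 ar.
have mb : measurable_fun I01 (fun t => r (circ t) - a (circ t)) by exact: measurable_funB.
have Lb : Linf (fun z => ((r z - a z)%:C)%C).
  by apply: (Lar (fun z => r z - a z)) => // t; rewrite subr_ge0 ar gerBl a0.
rewrite (_ : alpha s = alpha (fun z => ((a z)%:C)%C + ((r z - a z)%:C)%C)); last first.
  rewrite (a_ae (Tsimple_Linf ss) Lr); last first.
    by apply: eq_on_circle_aeeq => t; rewrite /r -sE.
  by congr alpha; apply/funext => z; rewrite -rmorphD addrC subrK.
apply: (@le_trans _ _ ((alpha (fun z => ((a z)%:C)%C))%:E +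
    (alpha (fun z => ((r z - a z)%:C)%C))%:E)%E).
  by rewrite -EFinD lee_fin alpha_triangle.
apply: leeD; apply: alpha_le_ext => // t; rewrite normc_real ger0_norm ?subr_ge0//.
  by rewrite ge_min lexx orbT.
rewrite /a; have [h|h] := leP (r (circ t)) (normc (f (circ t))).
  by rewrite subrr normc_ge0.
by rewrite lerBlDl (le_trans (sle t))// le_normcD.
Qed.

(** If [s] is below [|f h|], then [s / M], restricted to where [|h| <= M], is simple and below
    [|f|]; the restriction alters [s] on a null set only. *)
Lemma alpha_ext_mul h : Linf h -> exists2 M : R, 0 < M &
  forall f, (alpha_ext alpha (fun z => (f z * h z)%R) <= M%:E * alpha_ext alpha f)%E.
Proof.
move=> Lh; have [M [M0 Lh' hh']] := Linf_cutoff Lh.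
exists M => // f; apply: ge_ereal_sup => _ [s [ss sfg] <-].
have [sE s0 sle] := simple_Re (f := fun z => f z * h z) ss sfg.
pose b z : R := (normc (h z) <= M)%R%:R.
have sb : Tsimple (fun z => ((b z)%:C)%C).
  apply: (@Tsimple_le_indic (fun z => normc (h z)) (fun=> M)).
    exact: cmeas_normc Lh.1.
  exact: measurable_cst.
have sbs := TsimpleM sb ss.
have ssM := TsimpleM (Tsimple_cst ((M^-1)%:C)%C) sbs.
have -> : alpha s = M * alpha (fun z => ((M^-1)%:C)%C * (((b z)%:C)%C * s z)).
  rewrite -a_scale ?(ltW M0)//; last exact: Tsimple_Linf.
  apply: a_ae; [exact: Tsimple_Linf| |].
    by apply: LinfM; [exact: Linf_cst|exact: Tsimple_Linf].
  apply: negligibleS hh' => t [It /= N]; split=> //= hE; apply: N.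
  rewrite mulrA -rmorphM divff ?gt_eqF// mul1r /b.
  have [hM|hM] := leP (normc (h (circ t))) M; first by rewrite mul1r.
  (* Where [h] equals its cutoff, a modulus above [M] would make [h] vanish, a contradiction. *)
  have h0 : h (circ t) = 0 by rewrite hE /cutoff leNgt hM mul0r.
  by move: hM; rewrite h0 normc0 ltNge ltW.
rewrite EFinM; apply: lee_wpmul2l; first by rewrite lee_fin ltW.
apply: ereal_sup_ubound; eexists; last reflexivity.
split=> // t; rewrite sE -!rmorphM normcC ler0c lecR /b.
have [hM|hM] := leP (normc (h (circ t))) M; last first.
  by rewrite /= mul0r mulr0 lexx normc_ge0.
rewrite /= mul1r mulr_ge0 ?invr_ge0 ?(ltW M0) ?s0//= mulrC ler_pdivrMr//.
by rewrite (le_trans (sle t))// normcM ler_wpM2l ?normc_ge0.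
Qed.

End RotationallySymmetricNorm.

(** * Rotation invariance of [p], and its constancy *)

Section NOuter.
Context {R : realType}.
Local Notation C := R[i].
Local Notation circ := (@circ R).
Local Notation mu := (@lebesgue_measure R).
Implicit Types f g h : cfun R.

(** Each coefficient is a Fourier coefficient, hence an integral that ignores null sets; [c = 1] and
    [c = -i] recover its two parts. *)
Lemma poly_ae0 (p : {poly C}) : aeeq (fun z => p.[z]) (fun=> 0) -> p = 0.
Proof.
move=> p0; apply/polyP => N; rewrite coef0.
have key (c : C) : complex.Re (c * p`_N) = 0.
  have := mean_trigpoly (c%:P * p) N (ltn0Sn 0); rewrite coefCM => <-.
  have t1 : trigpoly (fun t => circ t ^- (1 * N) * (c%:P * p).[circ t ^+ 1]).
    by exists N, (c%:P * p) => t; rewrite mul1n expr1.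
  have [bq _] := cbddmeas_trigpoly t1.
  apply: EFin_inj; rewrite EFin_mean//.
  rewrite (@ae_eq_integral _ _ _ mu _ (fun=> 0%E)).
  - by rewrite integral0.
  - exact: measurable_I01.
  - by apply/measurable_EFinP; exact: bq.1.
  - exact: measurable_cst.
  - apply: negligibleS p0 => t /= h.
    have [It|nIt] := pselect (Defs.I01 t); last by exfalso; apply: h => /nIt.
    by split=> //= pt; apply: h => _; rewrite expr1 hornerM pt !mulr0.
have := key 1; have := key (Complex 0 (-1)); case: (p`_N) => a b /=.
by rewrite !mul0r !mul1r mulN1r opprK add0r subr0 => -> ->.
Qed.

(** With [y = pi i / n] strictly between 0 and [pi], the real part is [1 - 2 sin(y)^2], which is
    less than 1. *)
Lemma circ_neq1 (i n : nat) : (0 < i < n)%N -> circ (n%:R^-1) ^+ i != 1.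
Proof.
move=> /andP[i0 iN]; rewrite -circ_natM; set y : R := pi * (i%:R / n%:R).
have n0 : (0 : R) < n%:R by rewrite ltr0n (leq_trans _ iN)//.
have sy : 0 < sin y.
  apply: sin_gt0_pi; rewrite /y mulr_gt0 ?pi_gt0 ?divr_gt0//= ?ltr0n//.
  by rewrite gtr_pMr ?pi_gt0// ltr_pdivrMr// mul1r ltr_nat.
apply/eqP => /(congr1 (@complex.Re R)) /=.
rewrite (_ : 2 * pi * (i%:R / n%:R) = y + y); last by rewrite /y; ring.
rewrite cosD -!expr2 => h; have := cos2Dsin2 y; rewrite -[RHS]h => /eqP.
rewrite eq_sym -subr_eq0 (_ : _ - _ = - (2 * sin y ^+ 2)); last by ring.
by rewrite oppr_eq0 mulf_eq0 pnatr_eq0/= expf_eq0/= gt_eqF.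
Qed.

Variables (alpha : cfun R -> R) (Hn : rot_sym_norm alpha).
Local Notation ext := (alpha_ext alpha).

Lemma Hinf_Tmeasurable f : Hinf f -> Tmeasurable_fun f.
Proof. by move=> [[]]. Qed.

Lemma Hinf_zn_cst n (c : C) : Hinf_zn n (fun=> c).
Proof. by exists (fun=> c) => //; exact: Hinf_cst. Qed.

Lemma alpha_ext0 : ext (fun=> 0) = 0%E.
Proof.
have [[_ aeq0 _ _ _] _ _ _] := Hn.
have a0 s : (forall t, s (circ t) = 0) -> Tsimple s -> alpha s = 0.
  move=> s0 ss; apply/(aeq0 _ (Tsimple_Linf ss)).
  exact: eq_on_circle_aeeq.
apply/eqP; rewrite eq_le; apply/andP; split.
  apply: ge_ereal_sup => _ [s [ss s0] <-]; rewrite a0// => t.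
  by apply/eqP; rewrite eq_le andbC; have := s0 t; rewrite normr0.
apply: ereal_sup_ubound; exists (fun=> 0).
  by split; [exact: Tsimple_cst|move=> t; rewrite normr0 lexx].
by rewrite a0//; exact: Tsimple_cst.
Qed.

Lemma sub_aclos (S : set (cfun R)) f : S f -> Tmeasurable_fun f -> aclos alpha S f.
Proof.
move=> Sf mf; split=> // e e0; exists f => //.
by under eq_fun do rewrite subrr; rewrite alpha_ext0 lte_fin.
Qed.

Lemma alpha_extB_lt f g h (e1 e2 : R) : Tmeasurable_fun f -> Tmeasurable_fun g ->
  Tmeasurable_fun h -> (ext (fun z => (f z - g z)%R) < e1%:E)%E ->
  (ext (fun z => (g z - h z)%R) < e2%:E)%E ->
  (ext (fun z => (f z - h z)%R) < (e1 + e2)%:E)%E.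
Proof.
move=> mf mg mh fg gh.
have -> : (fun z => f z - h z) = fun z => (f z - g z) + (g z - h z).
  by apply/funext => z; rewrite subrKA.
apply: le_lt_trans (alpha_ext_triangle Hn _ _) _; [exact: Tmeasurable_funB..|].
by rewrite EFinD lteD.
Qed.

Lemma approx_mulr f (S : set (cfun R)) h : Linf h -> aclos alpha S f ->
  forall e : R, 0 < e -> exists2 s, S s & (ext (fun z => (f z * h z - s z * h z)%R) < e%:E)%E.
Proof.
move=> Lh [_ fS] e e0; have [M M0 hM] := alpha_ext_mul Hn Lh.
have [s Ss fs] := fS (e / M) (divr_gt0 e0 M0).
exists s => //; under eq_fun do rewrite -mulrBl.
apply: le_lt_trans (hM _) _.
by rewrite -lte_pdivlMl// -EFinM mulrC.
Qed.

(** The polynomial [p] is approximated by [f h], and this by [q = s h], with [h] and [s] in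
    [H^infty(z^n)]. As [q] is invariant under rotation by [w], so is [p], and comparing coefficients
    gives [p_i (1 - w^i) = 0]. *)
Lemma n_outer_cst n f (p : {poly C}) : (0 < n)%N -> (size p <= n)%N ->
  aclos alpha (fmul f (@Hinf_zn R n)) = polymul p (Malpha alpha n) ->
  Malpha alpha n f -> p = (p`_0)%:P.
Proof.
move=> n0 pn pM Mf.
have mp (c : C) : Linf (fun z => p.[c * z]) by exact: Linf_horner.
have pE : (fun z => p.[z]) = fun z => p.[1 * z] by apply/funext => z; rewrite mul1r.
have Lp : Linf (fun z => p.[z]) by rewrite pE.
have : aclos alpha (fmul f (@Hinf_zn R n)) (fun z => p.[z]).
  rewrite pM; split; first exact: Lp.1.
  exists (fun=> 1); last by apply: eq_on_circle_aeeq => t; rewrite mulr1.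
  by apply: sub_aclos; [exact: Hinf_zn_cst|exact: cmeas_cst].
move=> [_ pf].
have mf : Tmeasurable_fun f by case: Mf.
set w := circ n%:R^-1.
have wn : w ^+ n = 1 by rewrite -circ_natM divff ?circ1// pnatr_eq0 -lt0n.
have w1 : `|w| = 1 by rewrite normcC normc_circ.
have [[age0 aeq0 _ _ _] _ _ _] := Hn.
pose d : cfun R := fun z => p.[z] - p.[w * z].
have Ld : Linf d by exact: LinfB.
have ad : alpha d = 0.
  apply/eqP; rewrite eq_le age0// andbT; apply/ler_addgt0Pr => e e0; rewrite add0r.
  have e4 : 0 < e / 4 by rewrite divr_gt0.
  have [_ [h Hh <-] ph] := pf _ e4.
  have Lh : Linf h by case: (Hinf_zn_sub n0 Hh).
  (* [f] may be unbounded; replacing it by [s], chosen after [h], makes [q] bounded, so that [alpha]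
     and its rotation invariance apply to [p - q]. *)
  have [s Hs fs] := approx_mulr Lh Mf e4.
  have Ls : Linf s by case: (Hinf_zn_sub n0 Hs).
  pose q : cfun R := fun z => s z * h z.
  have Lq : Linf q by exact: LinfM.
  have qw z : q (w * z) = q z.
    by rewrite /q; case: Hs => g _ ->; case: Hh => k _ ->; rewrite exprMn wn mul1r.
  have Lpq : Linf (fun z => p.[z] - q z) by exact: LinfB.
  have pq : alpha (fun z => p.[z] - q z) < e / 2.
    rewrite -lte_fin; apply: le_lt_trans (alpha_le_ext Hn Lpq (fun=> lexx _)) _.
    have -> : e / 2 = e / 4 + e / 4 by field.
    by apply: alpha_extB_lt ph fs; [exact: Lp.1|exact: Tmeasurable_funM mf Lh.1|exact: Lq.1].
  have Lpqw : Linf (fun z => p.[w * z] - q z) by exact: LinfB.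
  (* Since [q] is invariant, [d] is [p - q] minus its own rotate, and both have the same norm, below
     [e / 2]. *)
  have -> : d = fun z => (p.[z] - q z) + - (p.[w * z] - q z).
    by apply/funext => z; rewrite /d opprB addrA subrK.
  have LN : Linf (fun z => - (p.[w * z] - q z)).
    have := LinfM (Linf_cst (-1)) Lpqw.
    by under eq_fun do rewrite mulN1r.
  apply: le_trans (alpha_triangle Hn Lpq LN) _.
  rewrite (alpha_opp Hn Lpqw).
  have -> : (fun z => p.[w * z] - q z) = fun z => (fun z => p.[z] - q z) (w * z).
    by apply/funext => z /=; rewrite qw.
  rewrite (alpha_rot Hn Lpq w1); lra.
have /poly_ae0 dp : aeeq (fun z => (p - (p \Po (w *: 'X))).[z]) (fun=> 0).
  have := (aeq0 _ Ld).1 ad; congr aeeq; apply/funext => z.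
  by rewrite /d hornerD hornerN horner_comp hornerZ hornerX.
apply/polyP => -[|i]; rewrite coefC//=.
(* From index [n] on the coefficients vanish by the size bound; for indices strictly between 0 and
   [n], the power of [w] differs from 1. *)
have [ni|iN] := leqP n i.+1; first by rewrite nth_default// (leq_trans pn).
have := congr1 (fun r : {poly C} => r`_i.+1) dp.
rewrite coefB coef0 comp_polyE coef_sum.
have [pi_|ip] := leqP (size p) i.+1; first by rewrite nth_default.
rewrite (bigD1 (Ordinal ip))//= big1 => [|j /negbTE ji].
  rewrite exprZn coefZ coefZ coefXn eqxx mulr1 addr0 -{1}[p`_i.+1]mulr1 -mulrBr.
  move/eqP; rewrite mulf_eq0 => /orP[/eqP //|].
  by rewrite subr_eq0 eq_sym (negbTE (circ_neq1 _)).
rewrite exprZn !coefZ coefXn; case: eqP => [ij|_]; last by rewrite !mulr0.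
by move: ji; rewrite -val_eqE/= -ij eqxx.
Qed.

End NOuter.

(** * From a constant [p] to the density of [f H^infty] in [H^alpha] *)

Theorem theorem5p7 (R : realType) (alpha : cfun R -> R) (n : nat) :
  rot_sym_norm alpha -> cont_norm alpha -> (0 < n)%N ->
  forall f : cfun R, n_outer alpha n f -> Malpha alpha n f -> outer alpha f.
Proof.
move=> Hn _ n0 f [Hf [p [p0 pn pM]]] Mf.
have pE := n_outer_cst Hn n0 pn pM Mf.
set c := p`_0 in pE.
have c0 : c != 0 by apply: contraNneq p0 => c0; rewrite pE c0.
have mf : Tmeasurable_fun f by case: Hf.
(* As [p] is the nonzero constant [c], the function 1 is [p] times the constant [c^-1], which lies
   in [M_alpha(z^n)]. *)
have [_ one] : aclos alpha (fmul f (@Hinf_zn R n)) (fun=> 1).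
  rewrite pM; split; first exact: cmeas_cst.
  exists (fun=> c^-1); last first.
    by apply: eq_on_circle_aeeq => t; rewrite pE hornerC divff.
  by apply: (sub_aclos Hn); [exact: Hinf_zn_cst|exact: cmeas_cst].
split=> //; apply/seteqP; split=> u [mu_ uS]; split=> // e e0;
  have e2 : 0 < e / 2 by rewrite divr_gt0.
(* Closure of [f H^infty] inside [H^alpha]: approximating [f] by [s] in [H^infty] replaces [f h] by
   [s h], a product in the algebra [H^infty]. *)
- have [_ [h Hh <-] uh] := uS _ e2.
  have [s Hs fs] := approx_mulr Hn Hh.1 Hf e2.
  exists (fun z => s z * h z); first exact: HinfM.
  rewrite (splitr e); apply: (alpha_extB_lt Hn _ _ _ uh fs) => //.
    exact: Tmeasurable_funM (Hinf_Tmeasurable Hh).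
  by apply: Tmeasurable_funM; exact: Hinf_Tmeasurable.
(* Conversely, [u] is close to some [s] in [H^infty], and multiplying an approximation of 1 by [f h]
   with the bounded [s] brings [f (h s)] close to [s]. *)
- have [s Hs us] := uS _ e2.
  have one' : aclos alpha (fmul f (@Hinf_zn R n)) (fun=> 1).
    by split; [exact: cmeas_cst|exact: one].
  have [_ [h Hh <-] sh] := approx_mulr Hn Hs.1 one' e2.
  have Hh' := Hinf_zn_sub n0 Hh.
  have Hhs : Hinf (fun z => h z * s z) by exact: HinfM.
  exists (fun z => f z * (h z * s z)); first by exists (fun z => h z * s z).
  rewrite (splitr e); apply: (alpha_extB_lt Hn _ _ _ us) => //.
  + exact: Hinf_Tmeasurable.
  + by apply: Tmeasurable_funM => //; exact: Hinf_Tmeasurable.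
  + by move: sh; under eq_fun do rewrite mul1r -mulrA.
Qed.
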